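(* Let $G=(V,E)$ be a connected, locally finite, transitive graph and let $\Phi$ and $\Lambda$ denote the isoperimetric profile and spectral profile of $G$ respectively. Let $X=(X_n)_{n\geq 0}$ be the simple random walk on $G$ and $d$ the graph distance. If the random walk on $G$ is diffusive in the sense that $\liminf_{n\to\infty}\mathbb{P}(d(X_0,X_n)\leq Cn^{1/2})>0$ for some $C<\infty$, then $\Lambda\simeq\Phi^2$.
   Context: A graph is transitive if its automorphism group acts transitively on its vertices. For a symmetric stochastic matrix $P$ on a countable set $V$, the isoperimetric profile is $$\Phi_P(n)=\inf\Big\{\frac{1}{|\Omega|}\sum_{x\in\Omega,\,y\in V\setminus\Omega}P(x,y):\ \emptyset\neq\Omega\subset V,\ |\Omega|\leq n\Big\},$$ and the spectral profile is $\Lambda_P(n)=\inf\{\lambda_P(\Omega):\emptyset\neq\Omega\subset V,\ |\Omega|\leq n\}$, where $$\lambda_P(\Omega)=\inf\{\langle (I-P)f,f\rangle:\ \operatorname{support}(f)\subset\Omega,\ \|f\|_2=1\}$$ with $\ell^2(V)$ taken with respect to counting measure. These are defined for real $n\geq 1$. The profiles $\Phi,\Lambda$ of $G$ are those of its simple random walk transition matrix. For monotone non-negative real functions $f,g$ defined for all sufficiently large positive reals, $f\simeq g$ means that there exist positive constants $c_1,c_2,c_3,c_4$ and $x_0<\infty$ such that $c_1f(c_2x)\leq g(x)\leq c_3f(c_4x)$ for all $x\geq x_0$. *)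

(* Defs.v *)
From mathcomp Require Import all_boot all_order all_algebra finmap.
From mathcomp Require Import all_classical all_reals all_analysis.

Set Implicit Arguments.
Unset Strict Implicit.
Unset Printing Implicit Defensive.

Import Order.TTheory GRing.Theory Num.Theory.

Local Open Scope classical_set_scope.
Local Open Scope ring_scope.

Section Graph.
Variables (V : choiceType) (e : rel V).

(* Simple undirected graphs, given by their adjacency relation. *)
Definition simple_graph : Prop := symmetric e /\ irreflexive e.

Definition has_walk (x y : V) (n : nat) : Prop :=
  exists p : seq V, [/\ path e x p, last x p = y & size p = n].

Definition graph_connected : Prop := forall x y, exists n, has_walk x y n.

Definition locally_finite : Prop := forall x, finite_set [set y | e x y].

Definition degree (x : V) : nat := #|` fset_set [set y | e x y]|.

Definition automorphism (f : V -> V) : Prop :=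
  bijective f /\ forall x y, e (f x) (f y) = e x y.

Definition vertex_transitive : Prop :=
  forall x y, exists f, automorphism f /\ f x = y.

(* The least length of a walk from x to y (unspecified if there is none). *)
Definition graph_dist (x y : V) : nat :=
  get [set n | has_walk x y n /\ forall m, has_walk x y m -> (n <= m)%N].

(* In a connected, locally finite graph the first case only occurs for the
   one-vertex graph, on which the walk stays put; this makes the matrix stochastic. *)
Definition srw_matrix (R : realType) (x y : V) : R :=
  if degree x == 0%N then (x == y)%:R else (e x y)%:R / (degree x)%:R.

End Graph.

Section Profiles.
Variables (R : realType) (V : choiceType) (P : V -> V -> R).

Definition boundary_weight (Om : {fset V}) : R :=
  fine (\esum_(z in [set` Om] `*` ~` [set` Om]) (P z.1 z.2)%:E).

Definition isoperimetric_profile (n : R) : R :=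
  inf [set (#|` Om|%:R)^-1 * boundary_weight Om
      | Om in [set Om : {fset V} | Om != fset0 /\ #|` Om|%:R <= n]].

(* Only used below on finitely supported functions, so that all the sums over V
   are finite sums. *)
Definition l2_inner (f g : V -> R) : R := \sum_(x \in [set: V]) f x * g x.

Definition l2_norm (f : V -> R) : R := Num.sqrt (l2_inner f f).

Definition matrix_apply (f : V -> R) (x : V) : R :=
  \sum_(y \in [set: V]) P x y * f y.

Definition dirichlet_form (f : V -> R) : R :=
  l2_inner (fun x => f x - matrix_apply f x) f.

Definition spectral_gap (Om : {fset V}) : R :=
  inf [set dirichlet_form f
      | f in [set f : V -> R | (forall x, f x != 0 -> x \in Om) /\
                               l2_norm f = 1]].

Definition spectral_profile (n : R) : R :=
  inf [set spectral_gap Om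
      | Om in [set Om : {fset V} | Om != fset0 /\ #|` Om|%:R <= n]].

End Profiles.

(* The condition Pr(X_(n+1) = x_(n+1) | X_0 = x_0, ..., X_n = x_n) =
   P (x_n, x_(n+1)), multiplied out; the law of X_0 is arbitrary. *)
Definition markov_chain (R : realType) (V : choiceType) (P : V -> V -> R)
    (d : measure_display) (T : measurableType d) (Pr : probability T R)
    (X : nat -> T -> V) : Prop :=
  (forall n x, measurable (X n @^-1` [set x])) /\
  (forall n (x : nat -> V),
    Pr (\bigcap_(i in `I_n.+2) (X i @^-1` [set x i])) =
    (Pr (\bigcap_(i in `I_n.+1) (X i @^-1` [set x i])) *
      (P (x n) (x n.+1))%:E)%E).

Definition simple_random_walk (R : realType) (V : choiceType) (e : rel V)
    (d : measure_display) (T : measurableType d) (Pr : probability T R)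
    (X : nat -> T -> V) : Prop :=
  markov_chain (srw_matrix e R) Pr X.

Definition diffusive (R : realType) (V : choiceType) (e : rel V)
    (d : measure_display) (T : measurableType d) (Pr : probability T R)
    (X : nat -> T -> V) : Prop :=
  exists C : R,
    (0 < limn_einf (fun n => Pr [set w |
       ((graph_dist e (X 0%N w) (X n w))%:R <= C * Num.sqrt n%:R)%R]))%E.

Definition asymp_equiv (R : realType) (f g : R -> R) : Prop :=
  exists c1 c2 c3 c4 x0 : R,
    [/\ 0 < c1, 0 < c2, 0 < c3 & 0 < c4] /\
    forall x, x0 <= x -> c1 * f (c2 * x) <= g x <= c3 * f (c4 * x).

(* Main.v *)
(* The easy inequality [Phi^2 <= 8 Lambda] is Cheeger's: the coarea formula
   applied to [f^2].

   For the other one, take a finite set S with boundary ratio eps and let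
   P^j 1_S evolve. The energy of (P^j + P^(j+1)) 1_S is at most 2 (b_j - b_(j+1))
   with b_j = |P^j 1_S|_2^2, so one of the first m of these functions has energy
   at most 2 |S| / m. Its squared norm is at least b_m = <P^(2m) 1_S, 1_S>, which
   is at least (c - r D eps) |S| when the walk stays within distance r = C sqrt(2m)
   with probability c: a geodesic of length at most r starting in S and ending
   outside S has one of r steps crossing the boundary, and each step of a random
   geodesic is equidistributed by the mass transport principle. One can thus take
   m of order eps^-2, and truncating the function at a small level makes its
   support of size O(|S|).

   The mass transport principle, which can fail when inf Phi > 0, is proved for
   inf Phi = 0 by summing over Folner sets; when Phi is bounded below there is
   nothing to prove, as Lambda <= 1. *)
Require Import Defs.
From mathcomp Require Import all_boot all_order all_algebra finmap.
From mathcomp Require Import all_classical all_reals all_analysis.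
From mathcomp Require Import ring lra.

Import Order.TTheory GRing.Theory Num.Theory.

Local Open Scope ring_scope.

Set Implicit Arguments.
Unset Strict Implicit.
Unset Printing Implicit Defensive.

(** * Sums of finitely supported functions *)

Section FiniteSums.
Context (R : realType) (V : choiceType).
Implicit Types (W : {fset V}) (f g : V -> R).

Definition supp_in W f := forall x, x \notin W -> f x = 0.

Lemma supp_in_sub W W' f : {subset W <= W'} -> supp_in W f -> supp_in W' f.
Proof. by move=> s h x xW; apply: h; apply: contra xW; exact: s. Qed.

Lemma sum_widen W W' f : {subset W <= W'} -> supp_in W f ->
  \sum_(x <- W) f x = \sum_(x <- W') f x.
Proof.
move=> s h; apply: big_fset_incl; first by apply/fsubsetP.
by move=> x _; exact: h.
Qed.

Lemma l2_innerE W f g : supp_in W (fun x => f x * g x) ->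
  l2_inner f g = \sum_(x <- W) f x * g x.
Proof. by move=> h; rewrite /l2_inner (fsbigTE W _ h). Qed.

Lemma l2_innerEl W f g : supp_in W f -> l2_inner f g = \sum_(x <- W) f x * g x.
Proof. by move=> h; apply: l2_innerE => x /h ->; rewrite mul0r. Qed.

Lemma l2_innerEr W f g : supp_in W g -> l2_inner f g = \sum_(x <- W) f x * g x.
Proof. by move=> h; apply: l2_innerE => x /h ->; rewrite mulr0. Qed.

Lemma l2_inner_ge0 f : 0 <= l2_inner f f.
Proof. by apply: fsumr_ge0 => x _; rewrite -expr2 sqr_ge0. Qed.

Lemma sum_set_le W W' f : (forall x, 0 <= f x) -> {subset W <= W'} ->
  \sum_(x <- W) f x <= \sum_(x <- W') f x.
Proof.
move=> f0 s; pose g x := if x \in W then f x else 0.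
have -> : \sum_(x <- W) f x = \sum_(x <- W) g x.
  by apply: eq_big_seq => x xW; rewrite /g xW.
rewrite (sum_widen s); last by move=> x /negbTE xW; rewrite /g xW.
by apply: ler_sum => x _; rewrite /g; case: ifP.
Qed.

Lemma exists_common_fset W W' : exists U : {fset V},
  {subset W <= U} /\ {subset W' <= U}.
Proof. by exists (W `|` W')%fset; split=> x xW; rewrite inE xW ?orbT. Qed.

End FiniteSums.

(** * Symmetric Markov kernels with finite rows and their quadratic forms *)

Section Kernel.
Context (R : realType) (V : choiceType) (N : V -> {fset V}) (P : V -> V -> R).
Implicit Types (W : {fset V}) (f g : V -> R).

(** [N x] is any finite set containing the support of the row of [x], so that summing over it gives
    the full row sum. *)
Record kernel_on : Prop := KernelOn {
  kernel_supp : forall x y, y \notin N x -> P x y = 0;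
  kernel_sym : forall x y, P x y = P y x;
  kernel_ge0 : forall x y, 0 <= P x y;
  kernel_sum : forall x, \sum_(y <- N x) P x y = 1 }.

Hypothesis HP : kernel_on.

Local Notation A := (matrix_apply P).

Lemma matrix_applyE W f x : supp_in W (fun y => P x y * f y) ->
  A f x = \sum_(y <- W) P x y * f y.
Proof. by move=> h; rewrite /matrix_apply (fsbigTE W _ h). Qed.

Lemma matrix_applyEf W f x : supp_in W f -> A f x = \sum_(y <- W) P x y * f y.
Proof. by move=> h; apply: matrix_applyE => y /h ->; rewrite mulr0. Qed.

Lemma supp_in_row W f x : {subset N x <= W} -> supp_in W (fun y => P x y * f y).
Proof.
move=> s y yW; rewrite (kernel_supp HP) ?mul0r//.
by apply: contra yW; exact: s.
Qed.

Lemma matrix_applyEN W f x : {subset N x <= W} ->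
  A f x = \sum_(y <- W) P x y * f y.
Proof. by move=> s; apply/matrix_applyE/supp_in_row. Qed.

Lemma kernel_sumW W x : {subset N x <= W} -> \sum_(y <- W) P x y = 1.
Proof.
move=> s; rewrite -(kernel_sum HP x); apply/esym/sum_widen => // y.
exact: (kernel_supp HP).
Qed.

(** Large enough to carry the support of [A f], by symmetry, when [W] carries that of [f]. *)
Definition thicken W : {fset V} := (W `|` \bigcup_(x <- W) N x)%fset.

Lemma sub_thicken W : {subset W <= thicken W}.
Proof. by move=> x xW; rewrite inE xW. Qed.

Lemma N_thicken W x : x \in W -> {subset N x <= thicken W}.
Proof.
move=> xW y yN; rewrite inE; apply/orP; right.
by apply/bigfcupP; exists x => //; rewrite xW.
Qed.

Lemma supp_in_apply W f : supp_in W f -> supp_in (thicken W) (A f).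
Proof.
move=> h x xW; rewrite (matrix_applyEf _ h) big1_seq// => y /andP[_ yW].
rewrite (kernel_sym HP) (kernel_supp HP) ?mul0r//.
by apply: contra xW; exact: N_thicken.
Qed.

(** Only [f] is finitely supported: [g] may be the constant 1, which yields conservation of mass. *)
Lemma apply_adjoint W f g : supp_in W f -> l2_inner (A f) g = l2_inner f (A g).
Proof.
move=> h.
rewrite (l2_innerEl _ (supp_in_apply h)) (l2_innerEl _ h).
under eq_bigr do rewrite (matrix_applyEf _ h) mulr_suml.
rewrite exchange_big /=; apply: eq_big_seq => y yW.
rewrite (matrix_applyEN _ (N_thicken yW)) mulr_sumr.
apply: eq_bigr => x _; rewrite (kernel_sym HP); ring.
Qed.

Lemma apply_ge0 f : (forall x, 0 <= f x) -> forall x, 0 <= A f x.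
Proof.
by move=> f0 x; apply: fsumr_ge0 => y _; rewrite mulr_ge0// (kernel_ge0 HP).
Qed.

Lemma apply_le f g : (forall x, f x <= g x) -> forall x, A f x <= A g x.
Proof.
move=> fg x; rewrite !(@matrix_applyEN (N x))//.
by apply: ler_sum => y _; rewrite ler_wpM2l// (kernel_ge0 HP).
Qed.

Lemma apply1 x : A (fun=> 1) x = 1.
Proof.
rewrite (@matrix_applyEN (N x))// -[RHS](kernel_sum HP x).
by apply: eq_bigr => y _; rewrite mulr1.
Qed.

Lemma applyD f g : A (fun x => f x + g x) = (fun x => A f x + A g x).
Proof.
apply/funext => x; rewrite !(@matrix_applyEN (N x))// -big_split/=.
by apply: eq_bigr => y _; rewrite mulrDr.
Qed.

Lemma applyB f g : A (fun x => f x - g x) = (fun x => A f x - A g x).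
Proof.
apply/funext => x; rewrite !(@matrix_applyEN (N x))// -sumrB.
by apply: eq_bigr => y _; rewrite mulrBr.
Qed.

(* With [s = -1] this is twice the Dirichlet form, with [s = 1] it is the form
   of [I + P]; both are visibly nonnegative. *)
Lemma quadratic_formE W0 W f s : supp_in W0 f -> {subset thicken W0 <= W} ->
  s * s = 1 ->
  \sum_(x <- W) \sum_(y <- W) P x y * (f x + s * f y) ^+ 2 =
  2 * (l2_inner f f + s * l2_inner (A f) f).
Proof.
move=> h s1 s2.
have hW : supp_in W f := supp_in_sub s1 (supp_in_sub (@sub_thicken W0) h).
(* Full row sums inside [W] are guaranteed only where [f x != 0]; elsewhere the term vanishes. *)
have rows x : f x != 0 -> \sum_(y <- W) P x y = 1.
  move=> fx; apply: kernel_sumW => y yN; apply/s1/(@N_thicken _ x) => //.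
  by apply: contraNT fx => /h ->.
have E1 : \sum_(x <- W) \sum_(y <- W) P x y * (f x * f x) = l2_inner f f.
  rewrite (l2_innerEl _ hW); apply: eq_bigr => x _; rewrite -mulr_suml.
  by have [->|/rows->] := eqVneq (f x) 0; rewrite ?mulr0// mul1r.
have E2 : \sum_(x <- W) \sum_(y <- W) P x y * (f y * f y) = l2_inner f f.
  rewrite exchange_big -E1 /=; apply: eq_bigr => x _; apply: eq_bigr => y _.
  by rewrite (kernel_sym HP).
have E3 : \sum_(x <- W) \sum_(y <- W) P x y * (f x * f y) = l2_inner (A f) f.
  rewrite (l2_innerEr _ hW); apply: eq_bigr => x _.
  by rewrite (matrix_applyEf _ hW) mulr_suml; apply: eq_bigr => y _; ring.
rewrite -E3.
have -> (a b : R) : 2 * (a + b) = a + a + 2 * b by ring.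
rewrite -{1}E1 -{1}E2 !mulr_sumr -!big_split/=; apply: eq_bigr => x _.
rewrite !mulr_sumr -!big_split/=; apply: eq_bigr => y _.
have -> : (f x + s * f y) ^+ 2 = f x * f x + 2 * s * (f x * f y) + s * s * (f y * f y).
  by ring.
by rewrite s2; ring.
Qed.

Lemma dirichletE W f : supp_in W f ->
  dirichlet_form P f = l2_inner f f - l2_inner (A f) f.
Proof.
move=> h; rewrite /dirichlet_form !(l2_innerEr _ h) -sumrB.
by apply: eq_bigr => x _; rewrite mulrBl.
Qed.

Lemma dirichlet_sumE W0 W f : supp_in W0 f -> {subset thicken W0 <= W} ->
  \sum_(x <- W) \sum_(y <- W) P x y * (f x - f y) ^+ 2 = 2 * dirichlet_form P f.
Proof.
move=> h s; rewrite (dirichletE h) -[- l2_inner _ _]mulN1r.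
rewrite -(quadratic_formE h s) ?mulrNN ?mulr1//.
by apply: eq_bigr => x _; apply: eq_bigr => y _; rewrite mulN1r.
Qed.

Lemma dirichlet_ge0 W f : supp_in W f -> 0 <= dirichlet_form P f.
Proof.
move=> h; rewrite -(pmulr_rge0 _ (ltr0Sn R 1)) -(@dirichlet_sumE W (thicken W))//.
apply: sumr_ge0 => x _; apply: sumr_ge0 => y _.
by rewrite mulr_ge0 ?sqr_ge0// (kernel_ge0 HP).
Qed.

Lemma dirichlet_contract W f g : supp_in W f -> supp_in W g ->
  (forall x y, `|g x - g y| <= `|f x - f y|) ->
  dirichlet_form P g <= dirichlet_form P f.
Proof.
move=> hf hg c; rewrite -(ler_pM2l (ltr0Sn R 1)).
rewrite -!(@dirichlet_sumE W (thicken W))//.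
apply: ler_sum => x _; apply: ler_sum => y _.
rewrite ler_wpM2l ?(kernel_ge0 HP)// -real_normK ?num_real//.
by rewrite -[leRHS]real_normK ?num_real// lerXn2r// nnegrE.
Qed.

Lemma signless_form_ge0 W f : supp_in W f ->
  0 <= l2_inner f f + l2_inner (A f) f.
Proof.
move=> h; rewrite -(pmulr_rge0 _ (ltr0Sn R 1)) -[l2_inner (A f) f]mul1r.
rewrite -(@quadratic_formE W (thicken W))// ?mulr1//.
apply: sumr_ge0 => x _; apply: sumr_ge0 => y _.
by rewrite mulr_ge0 ?sqr_ge0// (kernel_ge0 HP).
Qed.

End Kernel.

(** * The coarea inequality and Cheeger's inequality *)

Section Cheeger.
Context (R : realType) (V : choiceType) (N : V -> {fset V}) (P : V -> V -> R).
Hypothesis HP : kernel_on N P.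
Implicit Types (W S Om : {fset V}) (f g : V -> R).

(** A finite version of [boundary_weight], equal to it once [W] contains [thicken N S]. *)
Definition cut W S := \sum_(x <- S) \sum_(y <- W | y \notin S) P x y.

Lemma cutE W S : {subset S <= W} ->
  cut W S = \sum_(x <- W) \sum_(y <- W) P x y * ((x \in S) && (y \notin S))%:R.
Proof.
move=> s; rewrite /cut.
rewrite -(@sum_widen _ _ S W) => [||x /negbTE xS]//.
  apply: eq_big_seq => x xS; rewrite big_mkcond; apply: eq_bigr => y _.
  by rewrite xS; case: (y \in S); rewrite ?mulr0 ?mulr1.
by rewrite big1// => y _; rewrite xS mulr0.
Qed.

Lemma exists_argmin Om g : Om != fset0 ->
  exists2 x0, x0 \in Om & forall x, x \in Om -> g x0 <= g x.
Proof.
move=> /fset0Pn[x xOm].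
have [x0 _ h] := @arg_minP _ _ Om [` xOm]%fset xpredT (fun u => g (val u)) isT.
by exists (val x0) => [|y yOm]; [exact: valP | exact: (h [` yOm]%fset)].
Qed.

(* Discrete coarea inequality: peel off the lowest level set, which is a
   multiple of an indicator function. *)
Lemma coarea Om W g (phi : R) : {subset Om <= W} ->
  supp_in Om g -> (forall x, 0 <= g x) ->
  (forall S, {subset S <= Om} -> phi * #|` S|%:R <= cut W S) ->
  phi * \sum_(x <- Om) g x <=
    \sum_(x <- W) \sum_(y <- W) P x y * Num.max (g x - g y) 0.
Proof.
have [n] := ubnP #|` Om|; elim: n => // n IH in Om g *.
rewrite ltnS => cOm OmW gOm g0 iso.
have [->|Om0] := eqVneq Om fset0.
  rewrite big_seq_fset0 mulr0; apply: sumr_ge0 => x _; apply: sumr_ge0 => y _.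
  by rewrite mulr_ge0 ?(kernel_ge0 HP)// le_max lexx orbT.
have [x0 x0Om gmin] := exists_argmin g Om0.
pose m := g x0; pose g' x := g x - m * (x \in Om)%:R.
have g'0 x : 0 <= g' x.
  rewrite /g'; case: (boolP (x \in Om)) => xOm; last by rewrite mulr0 subr0.
  by rewrite mulr1 subr_ge0 gmin.
have sub : {subset (Om `\ x0)%fset <= Om} by move=> x; rewrite !inE => /andP[].
have g'supp : supp_in (Om `\ x0)%fset g'.
  move=> x; rewrite !inE negb_and negbK /g' => /orP[/eqP->|xOm].
    by rewrite x0Om mulr1 subrr.
  by rewrite (negbTE xOm) mulr0 subr0 gOm.
have -> : \sum_(x <- Om) g x = \sum_(x <- (Om `\ x0)%fset) g' x + m * #|` Om|%:R.
  rewrite (sum_widen sub)// card_fset_sum1 natr_sum mulr_sumr -big_split/=.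
  by apply: eq_big_seq => x xOm; rewrite /g' xOm mulr1 subrK.
rewrite mulrDr [phi * (m * _)]mulrCA.
(* Subtracting [m] on [Om] changes the positive part only for pairs leaving [Om], where it drops by
   exactly [m]; for pairs entering [Om] it is 0 before and after. *)
have -> : \sum_(x <- W) \sum_(y <- W) P x y * Num.max (g x - g y) 0 =
    \sum_(x <- W) \sum_(y <- W) P x y * Num.max (g' x - g' y) 0 + m * cut W Om.
  rewrite cutE// mulr_sumr -big_split/=; apply: eq_bigr => x _.
  rewrite mulr_sumr -big_split/=; apply: eq_bigr => y _.
  rewrite mulrCA -mulrDr; congr (_ * _).
  have [xOm|xOm] := boolP (x \in Om); have [yOm|yOm] := boolP (y \in Om);
    rewrite /g' ?(negbTE xOm) ?(negbTE yOm) ?xOm ?yOm/= ?mulr1 ?mulr0 ?subr0 ?addr0//.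
  - by congr Num.max; ring.
  - rewrite (gOm _ yOm) !subr0 !max_l ?subr_ge0 ?gmin//; ring.
  - by rewrite (gOm _ xOm) !sub0r !max_r// oppr_le0 ?subr_ge0 ?gmin.
apply: lerD; last by rewrite ler_wpM2l ?g0// iso.
apply: IH => //.
- move: cOm; rewrite (cardfsD1 x0) x0Om add1n; exact.
- by move=> x /sub/OmW.
- by move=> S SS; apply: iso => x /SS/sub.
Qed.

(** A difference of squares is [a * b] with [a] the difference and [b] the sum. The weighted bound
    [a * b <= 2 / phi * a ^+ 2 + phi / 8 * b ^+ 2] splits it between the Dirichlet form and the form
    of [I + P]. *)
Lemma cheeger Om W f (phi : R) : {subset thicken N Om <= W} ->
  supp_in Om f -> 0 <= phi ->
  (forall S, {subset S <= Om} -> phi * #|` S|%:R <= cut W S) ->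
  phi ^+ 2 * l2_inner f f <= 8 * dirichlet_form P f.
Proof.
move=> OmW h; rewrite le_eqVlt => /predU1P[<- _|phi0 iso].
  by rewrite expr0n/= mul0r mulr_ge0// (dirichlet_ge0 HP h).
have OmW' : {subset Om <= W} by move=> x /(sub_thicken N)/OmW.
have := @coarea Om W (fun x => f x * f x) phi OmW' _ _ iso.
have -> : \sum_(x <- Om) f x * f x = l2_inner f f by rewrite (l2_innerEl _ h).
have supp2 : supp_in Om (fun x => f x * f x) by move=> x /h ->; rewrite mulr0.
have pos2 x : 0 <= f x * f x by rewrite -expr2 sqr_ge0.
move=> /(_ supp2 pos2).
have : \sum_(x <- W) \sum_(y <- W) P x y * Num.max (f x * f x - f y * f y) 0 <=
   2 * phi^-1 * (2 * dirichlet_form P f) +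
   phi / 8 * (2 * (l2_inner f f + 1 * l2_inner (matrix_apply P f) f)).
  rewrite -(dirichlet_sumE HP h OmW) -(quadratic_formE HP h OmW) ?mulr1//.
  rewrite !mulr_sumr -big_split/=; apply: ler_sum => x _.
  rewrite !mulr_sumr -big_split/=; apply: ler_sum => y _.
  rewrite ![_ * (P x y * _)]mulrCA -mulrDr ler_wpM2l ?(kernel_ge0 HP)//.
  set a := f x - f y; set b := f x + 1 * f y.
  have -> : f x * f x - f y * f y = a * b by rewrite /a /b; ring.
  have q0 : 0 <= phi^-1 * (2 * a - phi / 2 * b) ^+ 2.
    by rewrite mulr_ge0 ?sqr_ge0// invr_ge0 ltW.
  have q1 : 0 <= phi^-1 * (2 * a + phi / 2 * b) ^+ 2.
    by rewrite mulr_ge0 ?sqr_ge0// invr_ge0 ltW.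
  have e0 : phi^-1 * (2 * a - phi / 2 * b) ^+ 2 =
      2 * (2 * phi^-1 * a ^+ 2 + phi / 8 * b ^+ 2 - a * b).
    by field; rewrite gt_eqF.
  have e1 : phi^-1 * (2 * a + phi / 2 * b) ^+ 2 =
      2 * (2 * phi^-1 * a ^+ 2 + phi / 8 * b ^+ 2 + a * b).
    by field; rewrite gt_eqF.
  by rewrite ge_max; apply/andP; split; lra.
have D := dirichletE P h; have D0 := dirichlet_ge0 HP h.
have -> : l2_inner (matrix_apply P f) f = l2_inner f f - dirichlet_form P f.
  by rewrite D; ring.
move: (dirichlet_form P f) (l2_inner f f) D0 => E n2 E0 H1 H2.
have {H1 H2} := le_trans H2 H1.
(* The weight [phi / 8] makes the [I + P] term at most half of the left side, so it can be
   absorbed. *)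
move=> H; have : phi * (phi * n2) <=
    phi * (2 * phi^-1 * (2 * E) + phi / 8 * (2 * (n2 + 1 * (n2 - E)))).
  by rewrite ler_pM2l.
have -> : phi * (2 * phi^-1 * (2 * E) + phi / 8 * (2 * (n2 + 1 * (n2 - E)))) =
   4 * E + phi ^+ 2 / 4 * (2 * n2 - E) by field; rewrite gt_eqF.
have : 0 <= phi ^+ 2 * E by rewrite mulr_ge0// sqr_ge0.
rewrite mulrA -expr2; nra.
Qed.

End Cheeger.

(** * Energy decrement, truncation, and bounds on the two profiles *)

Section Profiles.
Context (R : realType) (V : choiceType) (N : V -> {fset V}) (P : V -> V -> R).
Hypothesis HP : kernel_on N P.
Implicit Types (W S Om : {fset V}) (f g : V -> R).

Local Notation A := (matrix_apply P).

(* The spectral identity 2(1 - t^2) = (1 - t)(1 + t)^2 + (1 + t)(1 - t)^2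
   applied to P: both terms on the right are nonnegative forms. *)
Lemma energy_identity W g : supp_in W g ->
  dirichlet_form P (fun x => g x + A g x) +
  (l2_inner (fun x => g x - A g x) (fun x => g x - A g x) +
   l2_inner (A (fun x => g x - A g x)) (fun x => g x - A g x)) =
  2 * (l2_inner g g - l2_inner (A g) (A g)).
Proof.
move=> h; have hA := supp_in_apply HP h; have hAA := supp_in_apply HP hA.
rewrite (apply_adjoint HP _ h).
set U := thicken N W in hA hAA.
have h' : supp_in U g := supp_in_sub (@sub_thicken _ N W) h.
have sD : supp_in U (fun x => g x + A g x).
  by move=> x xU; rewrite h' // hA // addr0.
have sB : supp_in U (fun x => g x - A g x).
  by move=> x xU; rewrite h' // hA // subr0.
rewrite /dirichlet_form !(l2_innerEr _ sD) !(l2_innerEr _ sB) !(l2_innerEl _ h').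
rewrite (applyD HP) (applyB HP) -!big_split/= -sumrB mulr_sumr.
by apply: eq_bigr => x _; ring.
Qed.

(** Both forms on the left of [energy_identity] are nonnegative: dropping the one in [g - A g] gives
    the energy bound, dropping both gives monotonicity. *)
Lemma energy_decrement W g : supp_in W g ->
  dirichlet_form P (fun x => g x + A g x) <=
    2 * (l2_inner g g - l2_inner (A g) (A g)) /\
  l2_inner (A g) (A g) <= l2_inner g g.
Proof.
move=> h; have hA := supp_in_apply HP h.
have h' := supp_in_sub (@sub_thicken _ N W) h.
have sD : supp_in (thicken N W) (fun x => g x + A g x).
  by move=> x xU; rewrite h' // hA // addr0.
have sB : supp_in (thicken N W) (fun x => g x - A g x).
  by move=> x xU; rewrite h' // hA // subr0.
have := energy_identity h.
have := dirichlet_ge0 HP sD; have := signless_form_ge0 HP sB.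
split; lra.
Qed.

Lemma spectral_gap_set_ge0 S f : (forall x, f x != 0 -> x \in S) ->
  0 <= dirichlet_form P f.
Proof.
move=> h; apply: (dirichlet_ge0 HP (W := S)) => x xS; apply/eqP.
by apply: contraNT xS => /h.
Qed.

Lemma spectral_gap_le S f : supp_in S f ->
  spectral_gap P S * l2_inner f f <= dirichlet_form P f.
Proof.
move=> h; have := l2_inner_ge0 f; rewrite le_eqVlt => /predU1P[<-|f0].
  by rewrite mulr0 (dirichlet_ge0 HP h).
pose c := (Num.sqrt (l2_inner f f))^-1.
have c2 : c * c = (l2_inner f f)^-1.
  by rewrite /c -expr2 exprVn sqr_sqrtr// ltW.
have hc : supp_in S (fun x => c * f x) by move=> x /h ->; rewrite mulr0.
have l2c : l2_inner (fun x => c * f x) (fun x => c * f x) = 1.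
  have -> : l2_inner (fun x => c * f x) (fun x => c * f x) = (c * c) * l2_inner f f.
    rewrite (l2_innerEl _ hc) (l2_innerEl _ h) mulr_sumr.
    by apply: eq_bigr => x _; ring.
  by rewrite c2 mulVf// gt_eqF.
have dc : dirichlet_form P (fun x => c * f x) = dirichlet_form P f / l2_inner f f.
  rewrite -c2 /dirichlet_form (l2_innerEr _ hc) (l2_innerEr _ h) mulr_suml.
  apply: eq_bigr => x _; rewrite (matrix_applyEf _ _ hc) (matrix_applyEf _ _ h).
  have -> : \sum_(y <- S) P x y * (c * f y) = c * \sum_(y <- S) P x y * f y.
    by rewrite mulr_sumr; apply: eq_bigr => y _; ring.
  ring.
rewrite -ler_pdivlMr// -dc; apply: ge_inf.
  by exists 0 => _ [u [hu _] <-]; exact: spectral_gap_set_ge0 hu.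
exists (fun x => c * f x) => //; split.
  by move=> x; apply: contraNT => /hc ->.
by rewrite /l2_norm l2c sqrtr1.
Qed.

Lemma unit_vector_exists S : S != fset0 ->
  exists f : V -> R, (forall x, f x != 0 -> x \in S) /\ l2_norm f = 1.
Proof.
move=> /fset0Pn[x0 x0S]; exists (fun x => (x == x0)%:R); split.
  by move=> x; rewrite pnatr_eq0 eqb0 negbK => /eqP ->.
rewrite /l2_norm (@l2_innerEl _ _ [fset x0]%fset).
  by rewrite big_seq_fset1 eqxx mulr1 sqrtr1.
by move=> x; rewrite !inE => /negbTE ->.
Qed.

Lemma le_spectral_gap S c : S != fset0 ->
  (forall f, supp_in S f -> c * l2_inner f f <= dirichlet_form P f) ->
  c <= spectral_gap P S.
Proof.
move=> S0 h; apply: lb_le_inf.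
  by have [f hf] := unit_vector_exists S0; exists (dirichlet_form P f), f.
move=> _ [f [hf f1] <-].
have l1 : l2_inner f f = 1.
  by rewrite -[l2_inner f f]sqr_sqrtr ?l2_inner_ge0// -/(l2_norm f) f1 expr1n.
rewrite -[c]mulr1 -l1; apply: h => x xS; apply/eqP.
by apply: contraNT xS => /hf.
Qed.

Lemma spectral_gap_ge0 S : S != fset0 -> 0 <= spectral_gap P S.
Proof.
by move=> S0; apply: le_spectral_gap => // f h; rewrite mul0r (dirichlet_ge0 HP h).
Qed.

Lemma spectral_profile_le S f n : #|` S|%:R <= n -> supp_in S f ->
  spectral_profile P n * l2_inner f f <= dirichlet_form P f.
Proof.
move=> Sn h; have [S0|S0] := eqVneq S fset0.
  rewrite (l2_innerEl _ h) S0 big_seq_fset0 mulr0.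
  exact: (dirichlet_ge0 HP h).
apply: le_trans (spectral_gap_le h); rewrite ler_wpM2r ?l2_inner_ge0//.
apply: ge_inf; last by exists S.
by exists 0 => _ [u [u0 _] <-]; exact: spectral_gap_ge0.
Qed.

Lemma le_spectral_profile (x0 : V) n c : 1 <= n ->
  (forall S f, S != fset0 -> #|` S|%:R <= n -> supp_in S f ->
    c * l2_inner f f <= dirichlet_form P f) ->
  c <= spectral_profile P n.
Proof.
move=> n1 h; apply: lb_le_inf.
  exists (spectral_gap P [fset x0]%fset), [fset x0]%fset => //.
  split; last by rewrite cardfs1.
  by apply/fset0Pn; exists x0; rewrite inE.
move=> _ [S [S0 Sn] <-]; apply: le_spectral_gap => // f; exact: h.
Qed.

(** The indicator of a point has Dirichlet form [1 - P x0 x0]. *)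
Lemma spectral_profile_le1 (x0 : V) n : 1 <= n -> spectral_profile P n <= 1.
Proof.
move=> n1; pose f x : R := (x == x0)%:R.
have h : supp_in [fset x0]%fset f by move=> x; rewrite !inE /f => /negbTE ->.
have l1 : l2_inner f f = 1.
  by rewrite (l2_innerEl _ h) big_seq_fset1 /f eqxx mulr1.
have := @spectral_profile_le _ f n _ h; rewrite cardfs1 => /(_ n1).
rewrite l1 mulr1 => /le_trans; apply; rewrite (dirichletE P h) l1.
rewrite lerBlDr lerDl (l2_innerEr _ h) big_seq_fset1.
by rewrite mulr_ge0 ?ler0n//; apply: (apply_ge0 HP) => x; rewrite ler0n.
Qed.

(* If [f >= 0], the function [(f - t)_+] with [t = |f|_2^2 / (4 |f|_1)] keeps
   half of the squared norm and has support of size at most [|f|_1 / t]. *)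
Lemma spectral_profile_truncate W f n : supp_in W f -> (forall x, 0 <= f x) ->
  4 * (\sum_(x <- W) f x) ^+ 2 <= n * l2_inner f f ->
  spectral_profile P n * l2_inner f f <= 2 * dirichlet_form P f.
Proof.
move=> h f0 hn; have := l2_inner_ge0 f; rewrite le_eqVlt => /predU1P[f2|f2].
  by rewrite -f2 mulr0 mulr_ge0// (dirichlet_ge0 HP h).
set a := l2_inner f f in hn f2 *; set b := \sum_(x <- W) f x in hn *.
have b0 : 0 < b.
  rewrite lt_neqAle sumr_ge0// andbT; apply/eqP => b0.
  suff a0 : a = 0 by rewrite a0 ltxx in f2.
  rewrite /a (l2_innerEl _ h) big1_seq// => x /andP[_ xW].
  have : f x <= b.
    by rewrite /b (big_fsetD1 x)//= lerDl sumr_ge0.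
  by rewrite -b0 => fx; have -> : f x = 0 by [apply/eqP; rewrite eq_le fx f0]; rewrite mulr0.
pose t := a / (4 * b).
have t0 : 0 < t by rewrite divr_gt0// mulr_gt0.
pose g x := Num.max (f x - t) 0.
pose S := [fset x in W | t < f x]%fset.
have gS : supp_in S g.
  move=> x; rewrite /S !inE /= negb_and /g => /orP[xW|].
    by rewrite h// sub0r max_r// oppr_le0 ltW.
  by rewrite -leNgt => fx; rewrite max_r// subr_le0.
have gW : supp_in W g.
  by apply: supp_in_sub gS => x; rewrite !inE => /andP[].
have Eg : dirichlet_form P g <= dirichlet_form P f.
  apply: (dirichlet_contract HP h gW) => x y; rewrite /g.
  have [fx|fx] := leP (f x - t) 0; have [fy|fy] := leP (f y - t) 0.
  - by rewrite subrr normr0.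
  - by rewrite sub0r normrN gtr0_norm// ler0_norm; lra.
  - by rewrite subr0 gtr0_norm// ger0_norm; lra.
  - by rewrite le_eqVlt; apply/orP; left; apply/eqP; congr `|_|; ring.
have l2g : a <= 2 * l2_inner g g.
  (* Pointwise, [g x ^+ 2 >= f x ^+ 2 - 2 * t * f x]; the choice of [t] makes the total loss
     [a / 2]. *)
  have : a - 2 * t * b <= l2_inner g g.
    rewrite /a (l2_innerEl _ h) (l2_innerEl _ gW) mulr_sumr -sumrB.
    apply: ler_sum => x _; rewrite /g.
    have := f0 x; have [fx|fx] := leP (f x - t) 0; nra.
  have -> : 2 * t * b = a / 2 by rewrite /t; field; rewrite gt_eqF.
  lra.
have Sn : #|` S|%:R <= n.
  (* Markov's inequality at level [t]. *)
  have : t * #|` S|%:R <= b.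
    rewrite card_fset_sum1 natr_sum mulr_sumr.
    apply: (@le_trans _ _ (\sum_(x <- S) f x)).
      rewrite big_seq [leRHS]big_seq; apply: ler_sum => x.
      by rewrite !inE mulr1 => /andP[_ /ltW].
    by apply: sum_set_le => // x; rewrite !inE => /andP[].
  move=> tS; have : t * #|` S|%:R * (4 * b) <= b * (4 * b).
    by rewrite ler_wpM2r// mulr_ge0// ltW.
  have -> : t * #|` S|%:R * (4 * b) = #|` S|%:R * a.
    by rewrite /t; field; rewrite gt_eqF.
  have -> : b * (4 * b) = 4 * b ^+ 2 by ring.
  by move=> /le_trans/(_ hn); rewrite ler_pM2r.
have L := spectral_profile_le Sn gS.
have [Lm|Lp] := leP (spectral_profile P n) 0.
  apply: (@le_trans _ _ 0); first by rewrite mulr_le0_ge0// ltW.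
  by rewrite mulr_ge0// (dirichlet_ge0 HP h).
nra.
Qed.

(** Rows of points of [S] vanish outside [W], which reduces the extended-real sum to a finite
    one. *)
Lemma boundary_weightE W S : {subset thicken N S <= W} ->
  boundary_weight P S = cut P W S.
Proof.
move=> SW; rewrite /boundary_weight.
have inner x : x \in S -> \esum_(y in ~` [set` S]) (P x y)%:E =
    (\sum_(y <- W | y \notin S) P x y)%:E.
  move=> xS; rewrite (esumID [set` W]); last first.
    by move=> y _; rewrite lee_fin (kernel_ge0 HP).
  rewrite [X in (_ + X)%E]esum1 ?adde0; last first.
    move=> y [_ /negP yW]; congr EFin; apply: (kernel_supp HP).
    by apply: contra yW => yN; exact/SW/(N_thicken xS).
  rewrite esum_fset//; last 2 first.
  - by apply: finite_setIr; exact: finite_fset.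
  - by move=> y _; rewrite lee_fin (kernel_ge0 HP).
  rewrite (fsbigE [seq y <- W | y \notin S]) ?filter_uniq ?fset_uniq//.
  - rewrite -sumEFin -[in RHS]big_filter big_seq_cond [RHS]big_seq.
    apply: eq_bigl => y; rewrite mem_filter; apply/andP/idP => [[]//|yW].
    by split=> //; move: yW => /andP[/negP yS yW]; rewrite inE.
  - by move=> y /=; rewrite mem_filter => /andP[/negP ? ?]; split.
  - by move=> y /= [/negP yS yW]; rewrite mem_filter yS yW.
have -> : ([set` S] `*` ~` [set` S] = [set` S] `*`` (fun=> ~` [set` S]))%classic by [].
rewrite -(@esum_esum _ _ _ _ _ (fun x y => (P x y)%:E)); last first.
  by move=> x y _ _; rewrite lee_fin (kernel_ge0 HP).
rewrite (eq_esum (b := fun x => (\sum_(y <- W | y \notin S) P x y)%:E))//.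
rewrite esum_fset; last 2 first.
- exact: finite_fset.
- by move=> x _; rewrite lee_fin sumr_ge0// => y _; exact: (kernel_ge0 HP).
by rewrite -fsbig_seq ?fset_uniq// sumEFin.
Qed.

Lemma boundary_weight_ge0 S : 0 <= boundary_weight P S.
Proof.
rewrite (@boundary_weightE (thicken N S))//.
by apply: sumr_ge0 => x _; apply: sumr_ge0 => y _; exact: (kernel_ge0 HP).
Qed.

Lemma isoperimetric_profile_le S n : S != fset0 -> #|` S|%:R <= n ->
  isoperimetric_profile P n * #|` S|%:R <= boundary_weight P S.
Proof.
move=> S0 Sn; have S1 : (0 : R) < #|` S|%:R by rewrite ltr0n cardfs_gt0.
rewrite -ler_pdivlMr// mulrC; apply: ge_inf; last by exists S.
exists 0 => _ [u _ <-]; rewrite mulr_ge0 ?invr_ge0//.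
exact: boundary_weight_ge0.
Qed.

Lemma le_isoperimetric_profile (x0 : V) n c : 1 <= n ->
  (forall S, S != fset0 -> #|` S|%:R <= n ->
    c <= boundary_weight P S / #|` S|%:R) ->
  c <= isoperimetric_profile P n.
Proof.
move=> n1 h; apply: lb_le_inf.
  exists ((#|` [fset x0]%fset|%:R)^-1 * boundary_weight P [fset x0]%fset).
  exists [fset x0]%fset => //; split; last by rewrite cardfs1.
  by apply/fset0Pn; exists x0; rewrite inE.
by move=> _ [S [S0 Sn] <-]; rewrite mulrC; exact: h.
Qed.

Lemma isoperimetric_profile_ge0 (x0 : V) n : 1 <= n ->
  0 <= isoperimetric_profile P n.
Proof.
move=> n1; apply: (le_isoperimetric_profile x0) => // S _ _.
by rewrite divr_ge0// boundary_weight_ge0.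
Qed.

(** Subsets of a set of size at most [n] again have size at most [n], so the profile at [n] is an
    admissible [phi] in [cheeger]. *)
Lemma profile_cheeger (x0 : V) n : 1 <= n ->
  isoperimetric_profile P n ^+ 2 <= 8 * spectral_profile P n.
Proof.
move=> n1; rewrite mulrC -ler_pdivrMr//; apply: (le_spectral_profile x0) => //.
move=> S f S0 Sn h; rewrite mulrAC ler_pdivrMr// [leRHS]mulrC.
apply: (cheeger HP (W := thicken N S) _ h) => //.
  exact: isoperimetric_profile_ge0.
move=> S' SS'; have [->|S'0] := eqVneq S' fset0.
  by rewrite cardfs0 mulr0; apply: sumr_ge0 => x _; apply: sumr_ge0 => y _;
    exact: (kernel_ge0 HP).
have sub : {subset thicken N S' <= thicken N S}.
  move=> x; rewrite inE => /orP[/SS'|/bigfcupP[y /andP[/SS' yS _] xy]].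
    exact: sub_thicken.
  exact: (N_thicken yS).
rewrite -(boundary_weightE sub); apply: isoperimetric_profile_le => //.
by apply: le_trans Sn; rewrite ler_nat fsubset_leq_card//; apply/fsubsetP.
Qed.

End Profiles.

(** * Powers of the kernel applied to indicators *)

Section Iterates.
Context (R : realType) (V : choiceType) (N : V -> {fset V}) (P : V -> V -> R).
Hypothesis HP : kernel_on N P.
Implicit Types (W S : {fset V}) (f g : V -> R).

Local Notation A := (matrix_apply P).

Definition ind S (x : V) : R := (x \in S)%:R.

Lemma supp_ind S : supp_in S (ind S).
Proof. by move=> x /negbTE xS; rewrite /ind xS. Qed.

Lemma ind_ge0 S x : 0 <= ind S x. Proof. exact: ler0n. Qed.

Lemma ind_le1 S x : ind S x <= 1. Proof. by rewrite lern1 leq_b1. Qed.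

Lemma sum_ind S : \sum_(x <- S) ind S x = #|` S|%:R.
Proof.
rewrite card_fset_sum1 natr_sum.
by apply: eq_big_seq => x xS; rewrite /ind xS.
Qed.

Lemma supp_iter W f k : supp_in W f ->
  supp_in (iter k (thicken N) W) (iter k A f).
Proof. by move=> h; elim: k => //= k IH; exact: supp_in_apply. Qed.

Lemma iter_ge0 f k : (forall x, 0 <= f x) -> forall x, 0 <= iter k A f x.
Proof. by move=> f0; elim: k => //= k IH; exact: (apply_ge0 HP). Qed.

Lemma iter_apply_le f g k : (forall x, f x <= g x) ->
  forall x, iter k A f x <= iter k A g x.
Proof. by move=> fg; elim: k => //= k IH; exact: (apply_le HP). Qed.

Lemma iter_apply1 k : iter k A (fun=> 1) = fun=> 1.
Proof. by elim: k => //= k ->; apply/funext => x; exact: (apply1 HP). Qed.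

Lemma iter_le1 f k : (forall x, f x <= 1) -> forall x, iter k A f x <= 1.
Proof. by move=> f1 x; have := iter_apply_le k f1 x; rewrite iter_apply1. Qed.

Lemma iter_adjoint W f g k : supp_in W f ->
  l2_inner (iter k A f) g = l2_inner f (iter k A g).
Proof.
move=> h; elim: k g => //= k IH g.
by rewrite (apply_adjoint HP _ (supp_iter (k := k) h)) IH -iterSr.
Qed.

Lemma l2_inner1 W f : supp_in W f -> l2_inner f (fun=> 1) = \sum_(x <- W) f x.
Proof.
by move=> h; rewrite (l2_innerEl _ h); apply: eq_bigr => x _; rewrite mulr1.
Qed.

(** Conservation of mass: the powers are self-adjoint and fix the constant 1. *)
Lemma sum_iter W W' f k : supp_in W f -> supp_in W' (iter k A f) ->
  \sum_(x <- W') iter k A f x = \sum_(x <- W) f x.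
Proof.
move=> h h'.
by rewrite -(l2_inner1 h') -(l2_inner1 h) (iter_adjoint _ _ h) iter_apply1.
Qed.

(** [iter k A (ind [fset y]) x] is the [k]-step transition probability from [x] to [y]. *)
Lemma iter_kernelE W f k x : supp_in W f ->
  iter k A f x = \sum_(y <- W) iter k A (ind [fset y]%fset) x * f y.
Proof.
move=> h; elim: k x => [x|k IH x] /=.
  have [xW|xW] := boolP (x \in W).
    rewrite (big_fsetD1 x)//= {1}/ind inE eqxx mul1r big1_seq ?addr0// => y.
    by rewrite !inE /ind inE => /= /andP[/negbTE yx _]; rewrite eq_sym yx mul0r.
  rewrite h// big1_seq// => y /andP[_ yW]; rewrite /ind inE.
  by case: eqVneq => [xy|]; rewrite ?mul0r//; rewrite xy yW in xW.
rewrite (matrix_applyEN HP (W := N x))//.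
under [LHS]eq_bigr do rewrite IH mulr_sumr.
rewrite exchange_big /=; apply: eq_bigr => y _.
rewrite (matrix_applyEN HP (W := N x))// mulr_suml.
by apply: eq_bigr => z _; rewrite mulrA.
Qed.

Lemma ind_sub_apply_sum S : \sum_(x <- S) (1 - A (ind S) x) = boundary_weight P S.
Proof.
rewrite (boundary_weightE HP (W := thicken N S))// /cut.
apply: eq_big_seq => x xS.
rewrite -(kernel_sumW HP (N_thicken xS)) (matrix_applyEN HP _ (N_thicken xS)).
rewrite -sumrB [RHS]big_mkcond; apply: eq_bigr => y _.
by rewrite /ind; case: (y \in S); rewrite ?mulr1 ?subrr// mulr0 subr0.
Qed.

(** Since [P^k 1_S] lies between 0 and 1, one more step lowers the mass in [S] by at most
    [boundary_weight P S]. *)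
Lemma iter_escape S k :
  #|` S|%:R - k%:R * boundary_weight P S <=
  \sum_(x <- S) iter k A (ind S) x.
Proof.
elim: k => [|k IH]; first by rewrite mul0r subr0 sum_ind.
rewrite -addn1 natrD mulrDl mul1r opprD addrA.
apply: le_trans (_ : \sum_(x <- S) iter k A (ind S) x - boundary_weight P S <= _).
  by rewrite lerD2r.
set u := iter k A (ind S).
have sumS g : \sum_(x <- S) g x = l2_inner g (ind S).
  rewrite (l2_innerEr _ (@supp_ind S)); apply: eq_big_seq => x xS.
  by rewrite /ind xS mulr1.
have hu := supp_iter (k := k) (@supp_ind S); rewrite -/u in hu.
have -> : \sum_(x <- S) iter (k + 1) A (ind S) x = l2_inner u (A (ind S)).
  by rewrite addn1 sumS /= (apply_adjoint HP _ hu).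
rewrite sumS lerBlDr addrC -lerBlDr -ind_sub_apply_sum.
have SU : {subset S <= iter k (thicken N) S}.
  by elim: (k) => //= n IHn x /IHn; exact: sub_thicken.
have -> : \sum_(x <- S) (1 - A (ind S) x) =
    \sum_(x <- iter k (thicken N) S) ind S x * (1 - A (ind S) x).
  rewrite -(sum_widen SU) => [|x /supp_ind ->]; last by rewrite mul0r.
  by apply: eq_big_seq => x xS; rewrite /ind xS mul1r.
rewrite !(l2_innerEl _ hu) -sumrB; apply: ler_sum => x _.
have u0 : 0 <= u x by apply: iter_ge0 => y; exact: ind_ge0.
have u1 : u x <= 1 by apply: iter_le1 => y; exact: ind_le1.
have a0 : 0 <= A (ind S) x by apply: (apply_ge0 HP) => y; exact: ind_ge0.
have a1 : A (ind S) x <= 1 by apply: (@iter_le1 (ind S) 1) => y; exact: ind_le1.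
by rewrite /ind; case: (x \in S) => /=; nra.
Qed.

(* The energies of the functions P^j 1_S + P^(j+1) 1_S are bounded by the
   increments of a monotone sequence bounded by |S|, so one of the first m of
   them is at most 2|S|/m. *)
Lemma spectral_profile_smoothing S (m : nat) (c n : R) :
  S != fset0 -> (0 < m)%N -> 0 < c ->
  c * #|` S|%:R <= l2_inner (iter m A (ind S)) (iter m A (ind S)) ->
  16 / c * #|` S|%:R <= n ->
  spectral_profile P n <= 4 / (c * m%:R).
Proof.
move=> S0 m0 c0 cS Sn; set s : R := #|` S|%:R in cS Sn *.
have s0 : 0 < s by rewrite ltr0n cardfs_gt0.
have m0' : (0 : R) < m%:R by rewrite ltr0n.
pose b j := l2_inner (iter j A (ind S)) (iter j A (ind S)).
have bS j : dirichlet_form P (fun x => iter j A (ind S) x + A (iter j A (ind S)) x)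
      <= 2 * (b j - b j.+1) /\ b j.+1 <= b j.
  exact: (energy_decrement HP (supp_iter (k := j) (@supp_ind S))).
have [j [jm bj]] : exists j, (j < m)%N /\ b j - b j.+1 <= s / m%:R.
  apply: contrapT => /forallNP H.
  have {}H j : (j < m)%N -> s / m%:R < b j - b j.+1.
    by move=> jm; rewrite ltNge; apply/negP => ?; exact: (H j).
  (* Telescoping; strictness appears only after the first step, hence the two clauses. *)
  have G j : (j <= m)%N -> (j%:R * (s / m%:R) <= b 0%N - b j) /\
      ((0 < j)%N -> j%:R * (s / m%:R) < b 0%N - b j).
    elim: j => [_|j IH jm]; first by rewrite mul0r subrr.
    have [IH1 _] := IH (ltnW jm); have Hj := H _ jm.
    have -> : j.+1%:R * (s / m%:R) = j%:R * (s / m%:R) + s / m%:R.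
      by rewrite -addn1 natrD; ring.
    split=> [|_]; lra.
  have [_ /(_ m0)] := G m (leqnn m).
  have -> : m%:R * (s / m%:R) = s by field; rewrite gt_eqF.
  have -> : b 0%N = s.
    rewrite /b/= (l2_innerEl _ (@supp_ind S)) /s -sum_ind.
    by apply: eq_big_seq => x xS; rewrite /ind xS mulr1.
  by have := l2_inner_ge0 (iter m A (ind S)); rewrite -/(b m) => ? ?; lra.
have bmj : b m <= b j.
  have {}jm := ltnW jm; elim: (m) jm => [|k IH].
    by rewrite leqn0 => /eqP->.
  by rewrite leq_eqVlt => /predU1P[->//|/IH]; apply: le_trans; exact: (bS _).2.
set u := iter j A (ind S) in bj bmj.
have hu := supp_iter (k := j) (@supp_ind S); rewrite -/u in hu.
have u0 x : 0 <= u x by apply: iter_ge0 => y; exact: ind_ge0.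
have Au0 x : 0 <= A u x by exact: (apply_ge0 HP).
set W := thicken N (iter j (thicken N) S).
have hu' : supp_in W u := supp_in_sub (@sub_thicken _ N _) hu.
have hAu : supp_in W (A u) := supp_in_apply HP hu.
pose f x := u x + A u x.
have hf : supp_in W f by move=> x xW; rewrite /f hu'// hAu// addr0.
have sumf : \sum_(x <- W) f x = 2 * s.
  rewrite big_split/= (sum_iter (k := j) (@supp_ind S) hu').
  by rewrite (sum_iter (k := j.+1) (@supp_ind S) hAu) sum_ind -/s; ring.
have f2 : c * s <= l2_inner f f.
  apply: (le_trans cS); apply: (le_trans bmj).
  rewrite /b -/u (l2_innerEl _ hu') (l2_innerEl _ hf); apply: ler_sum => x _.
  by rewrite /f; have := u0 x; have := Au0 x; nra.
have cs0 : 0 < c * s by rewrite mulr_gt0.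
(* With total mass [2 * s] and squared norm at least [c * s], truncation asks for
   [n >= 4 * (2 * s) ^+ 2 / (c * s)], which is [16 / c * s]. *)
have trunc : spectral_profile P n * l2_inner f f <= 2 * dirichlet_form P f.
  apply: (spectral_profile_truncate HP hf) => [x|]; first by rewrite addr_ge0.
  rewrite sumf.
  have n0 : 0 <= n by apply: le_trans Sn; rewrite mulr_ge0// ?divr_ge0// ltW.
  have : n * (c * s) <= n * l2_inner f f by rewrite ler_wpM2l.
  apply: le_trans.
  have : 16 / c * s * (c * s) <= n * (c * s) by rewrite ler_wpM2r// ltW.
  apply: le_trans.
  have -> : 16 / c * s * (c * s) = 16 * s ^+ 2 by field; rewrite gt_eqF.
  by rewrite exprMn; lra.
have E : dirichlet_form P f <= 2 * (s / m%:R).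
  by apply: le_trans (bS j).1 _; rewrite ler_pM2l.
have [L|L] := leP (spectral_profile P n) 0.
  by apply: (le_trans L); rewrite divr_ge0// mulr_ge0// ltW.
have : spectral_profile P n * (c * s) <= 4 * (s / m%:R).
  apply: le_trans (_ : 2 * dirichlet_form P f <= _); last by lra.
  by apply: le_trans trunc; rewrite ler_pM2l.
rewrite -ler_pdivlMr// => /le_trans; apply.
rewrite le_eqVlt; apply/orP; left; apply/eqP.
by field; rewrite !gt_eqF.
Qed.

End Iterates.

(** * Bounding the law of a Markov chain by powers of its kernel *)

Section MarkovChains.
Local Open Scope classical_set_scope.
Local Open Scope ring_scope.
Context (R : realType) (V : choiceType) (N : V -> {fset V}) (P : V -> V -> R).
Hypothesis HP : kernel_on N P.
Context (d : measure_display) (T : measurableType d) (Pr : probability T R).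
Context (X : nat -> T -> V).
Hypothesis X_markov : markov_chain P Pr X.
Implicit Types (W Q : {fset V}) (G : set T) (x : nat -> V).

Local Notation A := (matrix_apply P).

Let measurable_pt n v : measurable (X n @^-1` [set v]) := X_markov.1 n v.

Lemma preimage_cons n v (s : seq V) :
  X n @^-1` [set` v :: s] = X n @^-1` [set v] `|` X n @^-1` [set` s].
Proof.
apply/seteqP; split => w /=; rewrite inE; first by move=> /orP[/eqP|]; [left|right].
by move=> [->|->]; rewrite ?eqxx ?orbT.
Qed.

Lemma measurable_seq n (s : seq V) : measurable (X n @^-1` [set` s]).
Proof.
elim: s => [|v s IH]; last by rewrite preimage_cons; exact: measurableU.
by rewrite (_ : _ @^-1` _ = set0)//; apply/seteqP; split.
Qed.

Lemma Pr_seq G n (s : seq V) : measurable G -> uniq s ->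
  Pr (G `&` X n @^-1` [set` s]) = (\sum_(v <- s) Pr (G `&` X n @^-1` [set v]))%E.
Proof.
move=> mG; elim: s => [_|v s IH /= /andP[vs us]].
  rewrite big_nil (_ : _ `&` _ = set0) ?measure0//.
  by apply/seteqP; split => // w [].
rewrite preimage_cons setIUr big_cons measureU.
- by congr (_ + _)%E; exact: IH.
- by apply: measurableI => //; exact: measurable_pt.
- by apply: measurableI => //; exact: measurable_seq.
- apply/seteqP; split => // w [[_ /= wv] [_ /= ws]].
  by rewrite wv in ws; rewrite ws in vs.
Qed.

Lemma Pr_setC_split G B : measurable G -> measurable B ->
  Pr G = (Pr (G `&` B) + Pr (G `&` ~` B))%E.
Proof.
move=> mG mB; rewrite -measureU.
- by rewrite -setIUr setUv setIT.
- exact: measurableI.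
- by apply: measurableI => //; exact: measurableC.
- by apply/seteqP; split => // w [[_ ?] [_ ?]].
Qed.

Definition cylinder n x : set T := \bigcap_(i in `I_n.+1) (X i @^-1` [set x i]).

Lemma measurable_cylinder n x : measurable (cylinder n x).
Proof. by apply: bigcap_measurable => //; exists 0%N. Qed.

Definition extend n x v : nat -> V := fun i => if (i <= n)%N then x i else v.

Lemma cylinder_extend n x v :
  cylinder n.+1 (extend n x v) = cylinder n x `&` X n.+1 @^-1` [set v].
Proof.
apply/seteqP; split => w.
  move=> h; split=> [i /= iN|]; last first.
    by have := h n.+1 (ltnSn _); rewrite /= /extend ltnn.
  have := h i (ltnW iN); rewrite /= /extend.
  by rewrite ltnS in iN; rewrite iN.
move=> [h hn] i /= iN; rewrite /extend; case: leqP => ni; first exact: h.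
by have -> : i = n.+1 by apply/eqP; rewrite eqn_leq -ltnS iN ni.
Qed.

Lemma Pr_cylinder_extend n x v :
  Pr (cylinder n x `&` X n.+1 @^-1` [set v]) =
  (Pr (cylinder n x) * (P (x n) v)%:E)%E.
Proof.
rewrite -cylinder_extend [LHS](X_markov.2 n (extend n x v)).
rewrite {2 3}/extend leqnn ltnn; congr (Pr _ * _)%E.
by apply: eq_bigcapr => i /= iN; rewrite /extend -ltnS iN.
Qed.

(** The transition probabilities into [N (x n)] already add up to 1, so the remaining part of the
    cylinder is null, without any countability of [V]. *)
Lemma Pr_cylinder_leave n x :
  Pr (cylinder n x `&` ~` (X n.+1 @^-1` [set` N (x n)])) = 0%E.
Proof.
have mc := measurable_cylinder n x.
have := Pr_setC_split mc (measurable_seq n.+1 (N (x n))).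
rewrite Pr_seq ?fset_uniq//.
under eq_bigr do rewrite Pr_cylinder_extend.
have : Pr (cylinder n x) \is a fin_num by exact: fin_num_measure.
move=> /fineK <-; set a := fine _.
have -> : (\sum_(v <- N (x n)) a%:E * (P (x n) v)%:E)%E = a%:E.
  under eq_bigr do rewrite -EFinM.
  by rewrite sumEFin -mulr_sumr (kernel_sum HP) mulr1.
set Z := Pr _; have : Z \is a fin_num.
  apply: fin_num_measure; apply: measurableI => //.
  by apply: measurableC; exact: measurable_seq.
move=> /fineK <-; rewrite -EFinD => -[] /eqP.
by rewrite -subr_eq0 opprD addNKr oppr_eq0 => /eqP ->.
Qed.

(** Induction on [k] for all cylinders: split by the value of [X n.+1], almost surely in [N (x n)],
    and append it to the cylinder. *)
Lemma markov_bound k n x Q :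
  (Pr (cylinder n x `&` X (n + k) @^-1` [set` Q]) <=
   Pr (cylinder n x) * (iter k A (ind R Q) (x n))%:E)%E.
Proof.
elim: k n x => [|k IH] n x.
  rewrite addn0 /= /ind; have [xQ|xQ] := boolP (x n \in Q).
    rewrite mule1; apply: le_measure; rewrite ?inE//; last exact: measurable_cylinder.
    apply: measurableI; first exact: measurable_cylinder.
    exact: measurable_seq.
  rewrite mule0 (_ : _ `&` _ = set0) ?measure0//.
  apply/seteqP; split => // w [h /= hQ].
  by rewrite (h n (ltnSn n)) (negbTE xQ) in hQ.
have mc := measurable_cylinder n x.
have mE : measurable (cylinder n x `&` X (n + k.+1) @^-1` [set` Q]).
  by apply: measurableI => //; exact: measurable_seq.
rewrite (Pr_setC_split mE (measurable_seq n.+1 (N (x n)))).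
rewrite [X in (_ + X)%E](_ : _ = 0%E) ?adde0; last first.
  apply/eqP; rewrite eq_le measure_ge0 andbT -(Pr_cylinder_leave n x).
  apply: le_measure; rewrite ?inE.
  - by apply: measurableI => //; apply: measurableC; exact: measurable_seq.
  - by apply: measurableI => //; apply: measurableC; exact: measurable_seq.
  - by move=> w [[? _] ?].
rewrite Pr_seq ?fset_uniq// /=.
apply: (@le_trans _ _ (\sum_(v <- N (x n)) (Pr (cylinder n x) * (P (x n) v)%:E) *
    (iter k A (ind R Q) v)%:E)%E).
  apply: lee_sum => v _; have := IH n.+1 (extend n x v).
  rewrite cylinder_extend Pr_cylinder_extend {1}/extend ltnn addSnnS.
  by apply: le_trans; rewrite setIAC.
have : Pr (cylinder n x) \is a fin_num by exact: fin_num_measure.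
move=> /fineK <-; set a := fine _.
under eq_bigr do rewrite -!EFinM.
rewrite sumEFin -EFinM lee_fin (matrix_applyEN HP (W := N (x n)))// mulr_sumr.
by apply: ler_sum => v _; rewrite mulrA.
Qed.

End MarkovChains.

(** * Distances and automorphisms of a transitive graph *)

Section Graphs.
Context (V : choiceType) (e : rel V).
Hypotheses (e_simple : simple_graph e) (e_conn : graph_connected e).
Hypotheses (e_fin : locally_finite e) (e_trans : vertex_transitive e).

Local Notation dist := (graph_dist e).

Let e_sym : symmetric e := e_simple.1.

Definition nbr (x : V) : {fset V} := fset_set [set y | e x y]%classic.

Lemma in_nbr x y : (y \in nbr x) = e x y.
Proof.
by rewrite in_fset_set ?(e_fin x)//; apply/idP/idP => [/set_mem//|?]; exact/mem_set.
Qed.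

(** The vertex itself is included because on the one-vertex graph the walk stays put. *)
Definition cnbr (x : V) : {fset V} := (x |` nbr x)%fset.

Lemma cnbr_edge x y : e x y -> y \in cnbr x.
Proof. by move=> xy; rewrite !inE in_nbr xy orbT. Qed.

Lemma dist_spec x y : has_walk e x y (dist x y) /\
  forall m, has_walk e x y m -> (dist x y <= m)%N.
Proof.
have [n hn] := e_conn x y.
apply: (@getPex _ [set n | has_walk e x y n /\
  forall m, has_walk e x y m -> (n <= m)%N]%classic).
have ex : exists n, `[< has_walk e x y n >] by exists n; apply/asboolP.
exists (ex_minn ex); case: ex_minnP => m /asboolP hm min; split=> // k hk.
by apply: min; apply/asboolP.
Qed.

Lemma dist_walk x y : has_walk e x y (dist x y).
Proof. exact: (dist_spec x y).1. Qed.

Lemma dist_min x y m : has_walk e x y m -> (dist x y <= m)%N.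
Proof. exact: (dist_spec x y).2. Qed.

Lemma has_walk_rcons x z y n : has_walk e x z n -> e z y -> has_walk e x y n.+1.
Proof.
move=> [p [xp pz pn]] zy; exists (rcons p y).
by rewrite rcons_path xp pz zy last_rcons size_rcons pn.
Qed.

(** Remove the last step of a shortest walk. *)
Lemma dist_pred x y : x != y -> exists2 z, e z y & (dist x z).+1 = dist x y.
Proof.
move=> xy; have [p [xp py pn]] := dist_walk x y.
case/lastP: p => [|p w] in xp py pn *; first by rewrite /= in py; rewrite py eqxx in xy.
rewrite last_rcons in py; rewrite {w}py rcons_path in xp pn *.
move: xp pn => /andP[xp zy]; rewrite size_rcons => pn.
exists (last x p) => //; apply/eqP; rewrite eqn_leq; apply/andP; split.
  by rewrite -pn ltnS; apply: dist_min; exists p.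
exact/dist_min/(has_walk_rcons (dist_walk _ _)).
Qed.

Lemma dist_eq0 x y : dist x y = 0%N -> x = y.
Proof.
by move=> d0; have := dist_walk x y; rewrite d0 => -[p [_ <- /size0nil->]].
Qed.

Lemma walk_ball x y k : has_walk e x y k -> y \in iter k (thicken cnbr) [fset x]%fset.
Proof.
move=> [p [xp <- <-]] {y k}; elim/last_ind: p xp => [_|p y IH] /=.
  by rewrite inE.
rewrite rcons_path last_rcons size_rcons => /andP[/IH xp zy] /=.
exact: (N_thicken xp (cnbr_edge zy)).
Qed.

Lemma sub_iter_thicken (N : V -> {fset V}) (W : {fset V}) m n : (m <= n)%N ->
  {subset iter m (thicken N) W <= iter n (thicken N) W}.
Proof.
move=> /subnK <-; elim: (n - m)%N => [//|k IH] x /IH; rewrite addSn.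
exact: sub_thicken.
Qed.

Lemma dist_ball x y k : (dist x y <= k)%N ->
  y \in iter k (thicken cnbr) [fset x]%fset.
Proof.
by move=> dk; apply: (sub_iter_thicken dk); exact/walk_ball/dist_walk.
Qed.

Lemma automorphism_inv f : automorphism e f ->
  exists2 g, automorphism e g & cancel f g /\ cancel g f.
Proof.
move=> [[g fg gf] fe]; exists g => //; split; first by exists f.
by move=> x y; rewrite -fe !gf.
Qed.

Lemma has_walk_aut f x y n : automorphism e f ->
  has_walk e x y n -> has_walk e (f x) (f y) n.
Proof.
move=> [_ fe] [p [xp py pn]]; exists (map f p); split.
- rewrite path_map; rewrite (eq_path (e' := e))//.
- by rewrite last_map py.
- by rewrite size_map.
Qed.

Lemma dist_aut f x y : automorphism e f -> dist (f x) (f y) = dist x y.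
Proof.
move=> hf; have [g hg [fg gf]] := automorphism_inv hf.
apply/eqP; rewrite eqn_leq !dist_min//; last exact/has_walk_aut/dist_walk.
by rewrite -{1}(fg x) -{1}(fg y); exact/has_walk_aut/dist_walk.
Qed.

Lemma nbr_aut f x : automorphism e f -> nbr (f x) = [fset f y | y in nbr x]%fset.
Proof.
move=> hf; have [g hg [fg gf]] := automorphism_inv hf.
apply/fsetP => y; rewrite in_nbr; apply/idP/imfsetP => /=.
  move=> fxy; exists (g y); rewrite ?gf// in_nbr.
  by rewrite -hf.2 gf.
by move=> [z]; rewrite in_nbr => xz ->; rewrite hf.2.
Qed.

Lemma degree_const x y : degree e x = degree e y.
Proof.
have [f [hf <-]] := e_trans x y.
rewrite /degree -!/(nbr _) nbr_aut// card_imfset//.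
by case: hf => /bij_inj.
Qed.

Lemma cnbr_aut f x : automorphism e f ->
  cnbr (f x) = [fset f y | y in cnbr x]%fset.
Proof. by move=> hf; rewrite /cnbr nbr_aut// imfsetU1. Qed.

(** * The simple random walk: mass transport and escape from a finite set *)

Section Walk.
Context (R : realType).

Local Notation P := (srw_matrix e R).
Local Notation A := (matrix_apply P).
Implicit Types (W S : {fset V}) (K : V -> V -> R).

(** Symmetry comes from transitivity, which makes all degrees equal. *)
Lemma srw_kernel : kernel_on cnbr P.
Proof.
split.
- move=> x y; rewrite !inE in_nbr negb_or => /andP[/negbTE yx /negbTE xy].
  by rewrite /srw_matrix [x == y]eq_sym yx xy mul0r; case: ifP.
- by move=> x y; rewrite /srw_matrix (degree_const x y) [x == y]eq_sym e_sym.
- by move=> x y; rewrite /srw_matrix; case: ifP => _; rewrite ?divr_ge0.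
- move=> x; rewrite (big_fsetD1 x) ?inE ?eqxx//= /srw_matrix.
  have -> : (cnbr x `\ x = nbr x)%fset.
    apply/fsetP => y; rewrite !inE in_nbr; case: eqVneq => //= ->.
    by rewrite e_simple.2.
  case: ifPn => dx.
    rewrite eqxx big1_seq ?addr0// => y /andP[_ yx].
    suff : nbr x = fset0 by move=> x0; rewrite x0 inE in yx.
    by apply/eqP; rewrite -cardfs_eq0.
  rewrite e_simple.2 mul0r add0r -mulr_suml.
  have -> : \sum_(y <- nbr x) (e x y)%:R = (degree e x)%:R :> R.
    rewrite /degree -/(nbr x) card_fset_sum1 natr_sum.
    by apply: eq_big_seq => y; rewrite in_nbr => ->.
  by rewrite divff// pnatr_eq0.
Qed.

Let HP := srw_kernel.

Lemma srw_aut f x y : automorphism e f -> P (f x) (f y) = P x y.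
Proof.
move=> hf; rewrite /srw_matrix (degree_const (f x) x) hf.2.
by rewrite (inj_eq (bij_inj hf.1)).
Qed.

Lemma iter_aut f u k x : automorphism e f ->
  iter k A u (f x) = iter k A (u \o f) x.
Proof.
move=> hf; elim: k x => //= k IH x; rewrite /matrix_apply.
rewrite (reindex_fsbigT f _ hf.1); apply: eq_fsbigr => y _ /=.
by rewrite srw_aut// IH.
Qed.

Lemma iter_ind_aut f x y k : automorphism e f ->
  iter k A (ind R [fset f y]%fset) (f x) = iter k A (ind R [fset y]%fset) x.
Proof.
move=> hf; rewrite iter_aut//; congr (iter k A _ x); apply/funext => z /=.
by rewrite /ind !inE (inj_eq (bij_inj hf.1)).
Qed.

(** Its inverse bounds transition probabilities along edges from below; the successor keeps it
    positive on the one-vertex graph. *)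
Definition edge_cost (x0 : V) : R := (degree e x0).+1%:R.

Lemma edge_cost_gt0 x0 : 0 < edge_cost x0.
Proof. by rewrite ltr0n. Qed.

Lemma edge_costP x0 x y : e x y -> 1 <= edge_cost x0 * P x y.
Proof.
move=> xy; rewrite /edge_cost /srw_matrix (degree_const x x0) xy.
have x00 : degree e x0 != 0%N.
  rewrite -(degree_const x) /degree -/(nbr x) cardfs_eq0.
  by apply/fset0Pn; exists y; rewrite in_nbr.
rewrite (negbTE x00) mul1r ler_pdivlMr ?ltr0n ?lt0n// mul1r.
by rewrite ler_nat leqnSn.
Qed.

Lemma walk_iter_ge x0 x y k : has_walk e x y k ->
  1 <= edge_cost x0 ^+ k * iter k A (ind R [fset y]%fset) x.
Proof.
move=> [p [xp py <-]] {k}; elim: p x xp py => [|z p IH] x /=.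
  by move=> _ ->; rewrite expr0 mul1r /ind inE eqxx.
move=> /andP[xz zp] py; rewrite exprSr.
have := edge_costP x0 xz; have := IH _ zp py.
set u := iter _ A _ => h1 h2.
have u0 w : 0 <= u w by apply: (iter_ge0 HP) => v; exact: ind_ge0.
have : P x z * u z <= A u x.
  rewrite (matrix_applyEN HP (W := cnbr x))// (big_fsetD1 z) ?cnbr_edge//=.
  by rewrite lerDl sumr_ge0// => w _; rewrite mulr_ge0// (kernel_ge0 HP).
move=> h3; apply: (@le_trans _ _ ((edge_cost x0 ^+ size p * u z) * (edge_cost x0 * P x z))).
  by rewrite -[1]mulr1 ler_pM.
have -> : edge_cost x0 ^+ size p * u z * (edge_cost x0 * P x z) =
  edge_cost x0 ^+ size p * edge_cost x0 * (P x z * u z) by ring.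
by rewrite ler_wpM2l// mulr_ge0 ?exprn_ge0 ?ltW ?edge_cost_gt0.
Qed.

Lemma sum_le_supp W B (f : V -> R) : (forall x, 0 <= f x) -> supp_in B f ->
  \sum_(x <- W) f x <= \sum_(x <- B) f x.
Proof.
move=> f0 h; have [U [WU BU]] := exists_common_fset W B.
by rewrite (sum_widen BU h); exact: sum_set_le.
Qed.

Lemma cut_le W S : cut P W S <= boundary_weight P S.
Proof.
rewrite (boundary_weightE HP (W := thicken cnbr S))//.
rewrite /cut big_seq [leRHS]big_seq; apply: ler_sum => x xS.
rewrite big_mkcond [leRHS]big_mkcond; apply: sum_le_supp => y.
  by case: ifP => // _; exact: (kernel_ge0 HP).
move=> yS; case: ifP => // _; apply: (kernel_supp HP).
by apply: contra yS; exact: N_thicken.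
Qed.

(** Total mass is conserved, so the mass outside [S] is what [iter_escape] allows [S] to lose. *)
Lemma escape_outside S (U : {fset V}) k :
  \sum_(x <- U | x \notin S) iter k A (ind R S) x <= k%:R * boundary_weight P S.
Proof.
have h := supp_iter HP (k := k) (@supp_ind R V S).
set W := iter k (thicken cnbr) S in h.
have SW : {subset S <= W} by exact: (@sub_iter_thicken cnbr S 0).
have u0 x : 0 <= iter k A (ind R S) x.
  by apply: (iter_ge0 HP) => y; exact: ind_ge0.
rewrite big_mkcond; apply: (@le_trans _ _
    (\sum_(x <- W) if x \notin S then iter k A (ind R S) x else 0)).
  apply: sum_le_supp => x; first by case: ifP.
  by move=> /h ->; case: ifP.
have := iter_escape HP S k; have := sum_iter HP (@supp_ind R V S) h.
rewrite sum_ind.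
have -> : \sum_(x <- W) iter k A (ind R S) x =
    \sum_(x <- S) iter k A (ind R S) x +
    \sum_(x <- W) if x \notin S then iter k A (ind R S) x else 0.
  have -> : \sum_(x <- S) iter k A (ind R S) x =
      \sum_(x <- W) if x \in S then iter k A (ind R S) x else 0.
    rewrite -(sum_widen SW) => [|x /negbTE->//].
    by apply: eq_big_seq => x ->.
  rewrite -big_split/=; apply: eq_bigr => x _.
  by case: (x \in S); rewrite /= ?addr0 ?add0r.
lra.
Qed.

Definition invariant K := forall f, automorphism e f ->
  forall x y, K (f x) (f y) = K x y.

(** [K x y] is the mass that [x] sends to [y]; quantifying over finite [W] avoids infinite sums. *)
Record transport K (l : nat) : Prop := Transport {
  transport_inv : invariant K;
  transport_ge0 : forall x y, 0 <= K x y;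
  transport_range : forall x y, K x y != 0 -> (dist x y <= l)%N;
  transport_out : forall x W, \sum_(y <- W) K x y <= 1 }.

(** Amenability: it makes the boundary term in the mass transport argument negligible. *)
Hypothesis folner : forall eps : R, 0 < eps ->
  exists2 S, S != fset0 & boundary_weight P S <= eps * #|` S|%:R.

(* Mass transport principle: summing [K] over a Folner set, the mass sent
   equals the mass received up to a boundary term. *)
Lemma mass_transport K l : transport K l ->
  forall y W, \sum_(x <- W) K x y <= 1.
Proof.
move=> [Kinv K0 Kl Kout] y0 W; set s := \sum_(x <- W) _.
pose D := edge_cost y0.
have D0 : 0 < D := edge_cost_gt0 y0.
pose C := \sum_(j < l.+1) D ^+ j * j%:R.
have C0 : 0 <= C by apply: sumr_ge0 => j _; rewrite mulr_ge0// exprn_ge0// ltW.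
have K1 x y : K x y <= 1.
  by have := Kout x [fset y]%fset; rewrite big_seq_fset1.
(* [K] is at most 1 and has range [l], so it is dominated by transition probabilities of at most [l]
   steps, to which [escape_outside] applies. *)
have KP x y : K x y <= \sum_(j < l.+1) D ^+ j * iter j A (ind R [fset y]%fset) x.
  have pos j : 0 <= D ^+ j * iter j A (ind R [fset y]%fset) x.
    rewrite mulr_ge0 ?exprn_ge0 ?(ltW D0)//.
    by apply: (iter_ge0 HP) => z; exact: ind_ge0.
  have [->|/Kl dl] := eqVneq (K x y) 0; first by apply: sumr_ge0.
  rewrite (bigD1 (Ordinal (dl : (dist x y < l.+1)%N)))//=.
  apply: (le_trans (K1 x y)); apply: (le_trans (walk_iter_ge y0 (dist_walk x y))).
  by rewrite lerDl sumr_ge0.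
have main S : S != fset0 -> #|` S|%:R * s <= #|` S|%:R + C * boundary_weight P S.
  move=> S0; have [phi hphi] := choice (fun y => e_trans y0 y).
  pose U := (S `|` \bigcup_(y <- S) [fset phi y x | x in W])%fset.
  have SU : {subset S <= U} by move=> x xS; rewrite inE xS.
  (* An automorphism taking [y0] to [y] maps [W] into [U], so [y] receives from [U] at least what
     [y0] receives from [W]. *)
  have step y : y \in S -> s <= \sum_(x <- U) K x y.
    move=> yS; have [hy yy] := hphi y.
    have -> : s = \sum_(x <- [fset phi y x | x in W]%fset) K x y.
      rewrite big_imfset/=; last by move=> a b _ _ /(bij_inj hy.1).
      by apply: eq_bigr => x _; rewrite -{2}yy Kinv.
    apply: sum_set_le => // x xW; rewrite inE; apply/orP; right.
    by apply/bigfcupP; exists y => //; rewrite yS.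
  apply: (@le_trans _ _ (\sum_(y <- S) \sum_(x <- U) K x y)).
    rewrite card_fset_sum1 natr_sum mulr_suml big_seq [leRHS]big_seq.
    by apply: ler_sum => y yS; rewrite mul1r step.
  (* Points of [S] send at most 1 each; what the others send into [S] is the boundary term. *)
  rewrite exchange_big /= (bigID (fun x => x \in S))/=; apply: lerD.
    rewrite big_mkcond; apply: (@le_trans _ _ (\sum_(x <- S) 1)).
      apply: (@le_trans _ _ (\sum_(x <- S) if x \in S then \sum_(y <- S) K x y else 0)).
        apply: sum_le_supp => x; last by move=> /negbTE ->.
        by case: ifP => // _; exact: sumr_ge0.
      by apply: ler_sum => x _; case: ifP => // _; exact: Kout.
    by rewrite card_fset_sum1 natr_sum.
  apply: (@le_trans _ _ (\sum_(x <- U | x \notin S)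
      \sum_(j < l.+1) D ^+ j * iter j A (ind R S) x)).
    apply: ler_sum => x _.
    apply: (@le_trans _ _ (\sum_(y <- S) \sum_(j < l.+1)
        D ^+ j * iter j A (ind R [fset y]%fset) x)); first exact: ler_sum.
    rewrite exchange_big le_eqVlt; apply/orP; left; apply/eqP => /=.
    apply: eq_bigr => j _; rewrite (iter_kernelE HP _ _ (@supp_ind R V S)) mulr_sumr.
    by apply: eq_big_seq => y yS; rewrite {3}/ind yS mulr1.
  rewrite exchange_big /= mulr_suml; apply: ler_sum => j _.
  rewrite -mulr_sumr -mulrA ler_wpM2l ?exprn_ge0 ?(ltW D0)//.
  exact: escape_outside.
apply/ler_addgt0Pr => eps eps0.
(* [C] is 0 when [l] is 0, hence the division by [C + 1]. *)
have C1 : 0 < C + 1 by rewrite ltr_wpDl.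
have [S S0 bS] := folner (divr_gt0 eps0 C1).
have s0 : (0 : R) < #|` S|%:R by rewrite ltr0n cardfs_gt0.
rewrite -(ler_pM2l s0); apply: (le_trans (main S S0)).
rewrite mulrDr mulr1 lerD2l.
apply: (@le_trans _ _ ((C + 1) * boundary_weight P S)).
  by rewrite ler_wpM2r ?(boundary_weight_ge0 HP)// lerDl.
rewrite mulrC -ler_pdivlMr//; apply: (le_trans bS).
by rewrite mulrAC [X in _ <= X / _]mulrC.
Qed.

Lemma sum_cnbr_aut f (F : V -> R) x : automorphism e f ->
  \sum_(y <- cnbr (f x)) F y = \sum_(y <- cnbr x) F (f y).
Proof.
by move=> hf; rewrite cnbr_aut// big_imfset//= => a b _ _ /(bij_inj hf.1).
Qed.

Definition toward x z y : bool := e z y && ((dist x z).+1 == dist x y).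

(* The uniform distribution, as a function of [z], on the neighbours [z] of [y]
   that are closer to [x]; it is identically [0 / 0 = 0] when [y = x]. *)
Definition back x y z : R :=
  (toward x z y)%:R / \sum_(w <- cnbr y) (toward x w y)%:R.

Lemma back_supp x y z : ~~ toward x z y -> back x y z = 0.
Proof. by move=> /negbTE h; rewrite /back h mul0r. Qed.

Lemma back_ge0 x y z : 0 <= back x y z.
Proof. by rewrite divr_ge0// sumr_ge0. Qed.

Lemma toward_cnbr x z y : toward x z y -> z \in cnbr y.
Proof. by move=> /andP[zy _]; apply: cnbr_edge; rewrite e_sym. Qed.

Lemma sum_back x y : x != y -> \sum_(z <- cnbr y) back x y z = 1.
Proof.
move=> /dist_pred[z zy dz]; rewrite -mulr_suml divff// gt_eqF//.
have tz : toward x z y by rewrite /toward zy dz eqxx.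
by rewrite (big_fsetD1 z) ?(toward_cnbr tz)//= tz ltr_wpDr// sumr_ge0.
Qed.

Lemma sum_back_le1 x y W : \sum_(z <- W) back x y z <= 1.
Proof.
have [->|xy] := eqVneq x y.
  rewrite big1// => z _; apply: back_supp; apply/negP => /andP[_].
  have /eqP -> : dist y y == 0%N by rewrite -leqn0 dist_min//; exists [::].
  by [].
rewrite -(sum_back xy); apply: sum_le_supp => z; first exact: back_ge0.
by move=> zN; apply: back_supp; apply: contra zN; exact: toward_cnbr.
Qed.

Lemma back_le x y z : back x y z <= (e z y)%:R.
Proof.
case: (boolP (e z y)) => [_|zy]; last by rewrite back_supp// /toward (negbTE zy).
by have := sum_back_le1 x y [fset z]%fset; rewrite big_seq_fset1.
Qed.

Lemma back_aut f x y z : automorphism e f -> back (f x) (f y) (f z) = back x y z.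
Proof.
move=> hf; have tw w : toward (f x) (f w) (f y) = toward x w y.
  by rewrite /toward hf.2 !dist_aut.
by rewrite /back sum_cnbr_aut// tw; under eq_bigr do rewrite tw.
Qed.

(* [K] with the last step of a geodesic chosen uniformly at random removed. *)
Definition shorten K x z : R := \sum_(y <- cnbr z) K x y * back x y z.

Lemma shorten_ge_sum K x z W : (forall x y, 0 <= K x y) ->
  \sum_(y <- W) K x y * back x y z <= shorten K x z.
Proof.
move=> K0; apply: sum_le_supp => y; first by rewrite mulr_ge0// back_ge0.
move=> yz; rewrite back_supp ?mulr0//.
by apply: contra yz => /andP[zy _]; exact: cnbr_edge.
Qed.

(** Stepping back along geodesics is defined from the graph alone, creates no mass, and brings each
    target one step closer to its source. *)
Lemma transport_shorten K l : transport K l.+1 -> transport (shorten K) l.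
Proof.
move=> [Kinv K0 Kl Kout]; split.
- move=> f hf x z; rewrite /shorten sum_cnbr_aut//.
  by apply: eq_bigr => y _; rewrite Kinv// back_aut.
- by move=> x z; apply: sumr_ge0 => y _; rewrite mulr_ge0// back_ge0.
- move=> x z; apply: contraNT; rewrite -ltnNge => lz; apply/eqP.
  apply: big1 => y _; have [->|/Kl xy] := eqVneq (K x y) 0; first by rewrite mul0r.
  rewrite back_supp ?mulr0//; apply/negP => /andP[_ /eqP dz].
  by rewrite -dz ltnS leqNgt lz in xy.
- move=> x W.
  apply: (@le_trans _ _ (\sum_(z <- W) \sum_(y <- thicken cnbr W) K x y * back x y z)).
    rewrite big_seq [leRHS]big_seq; apply: ler_sum => z zW.
    apply: sum_set_le; last exact: N_thicken.
    by move=> y; rewrite mulr_ge0// back_ge0.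
  rewrite exchange_big/=; apply: le_trans (Kout x (thicken cnbr W)).
  apply: ler_sum => y _; rewrite -mulr_sumr -[leRHS]mulr1.
  by rewrite ler_wpM2l// sum_back_le1.
Qed.

(** Let [z] precede [y] on the geodesic. If [z] is outside [S], the shortened transport already
    escapes; otherwise the step from [z] to [y] crosses the boundary, and by [mass_transport] such
    an edge carries at most 1. *)
Lemma transport_escape_step K l S W : transport K l.+1 ->
  \sum_(x <- S) \sum_(y <- W | y \notin S) K x y <=
  \sum_(x <- S) \sum_(z <- thicken cnbr W | z \notin S) shorten K x z +
  \sum_(z <- S) \sum_(y <- W | y \notin S) (e z y)%:R.
Proof.
move=> hK; have [Kinv K0 Kl Kout] := hK; have Kin := mass_transport hK.
apply: (@le_trans _ _ (\sum_(x <- S)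
   (\sum_(z <- thicken cnbr W | z \notin S) shorten K x z +
    \sum_(z <- S) \sum_(y <- W | y \notin S) (e z y)%:R * K x y))).
  rewrite big_seq [leRHS]big_seq; apply: ler_sum => x xS.
  apply: (@le_trans _ _ (\sum_(y <- W | y \notin S)
      \sum_(z <- thicken cnbr W) K x y * back x y z)).
    rewrite big_seq_cond [leRHS]big_seq_cond; apply: ler_sum => y /andP[yW yS].
    have xy : x != y by apply: contraNneq yS => <-.
    rewrite -mulr_sumr -[leLHS]mulr1 ler_wpM2l// -(sum_back xy).
    by apply: sum_set_le; [move=> z; exact: back_ge0 | exact: N_thicken].
  rewrite exchange_big/= (bigID (fun z => z \in S))/= addrC; apply: lerD.
    apply: ler_sum => z _; apply: le_trans (shorten_ge_sum x z W K0).
    rewrite big_mkcond; apply: ler_sum => y _; case: ifP => // _.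
    by rewrite mulr_ge0// back_ge0.
  rewrite big_mkcond/=.
  apply: (@le_trans _ _ (\sum_(z <- S)
      if z \in S then \sum_(y <- W | y \notin S) K x y * back x y z else 0)).
    apply: sum_le_supp => z; last by move=> /negbTE ->.
    by case: ifP => // _; apply: sumr_ge0 => y _; rewrite mulr_ge0// back_ge0.
  apply: ler_sum => z _; case: ifP => _; last by apply: sumr_ge0 => y _; exact: mulr_ge0.
  by apply: ler_sum => y _; rewrite mulrC ler_wpM2r// back_le.
rewrite big_split/= lerD2l exchange_big/=; apply: ler_sum => z _.
rewrite exchange_big/=; apply: ler_sum => y _.
by rewrite -mulr_sumr -[leRHS]mulr1 ler_wpM2l.
Qed.

(** Shorten [l] times, paying for the boundary edges each time; at range 0 no mass moves. *)
Lemma transport_escape K l S W (x0 : V) : transport K l ->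
  \sum_(x <- S) \sum_(y <- W | y \notin S) K x y <=
  l%:R * (edge_cost x0 * boundary_weight P S).
Proof.
elim: l => [|l IH] in K W * => hK.
  rewrite mul0r big_seq big1// => x xS; rewrite big1// => y yS; apply/eqP.
  apply: contraNT yS => /(transport_range hK).
  by rewrite leqn0 => /eqP/dist_eq0 <-.
apply: (le_trans (transport_escape_step S W hK)).
rewrite -addn1 natrD mulrDl mul1r; apply: lerD.
  exact/IH/transport_shorten.
apply: (@le_trans _ _ (edge_cost x0 * cut P W S)); last first.
  by rewrite ler_wpM2l ?cut_le// ltW// edge_cost_gt0.
rewrite mulr_sumr; apply: ler_sum => z _; rewrite mulr_sumr; apply: ler_sum => y _.
case: (boolP (e z y)) => [|_]; first exact: edge_costP.
by rewrite mulr_ge0 ?(kernel_ge0 HP)// ltW// edge_cost_gt0.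
Qed.

(** The graph ball, cut out of an iterated thickening to make it a finite set. *)
Definition gball x (r : nat) : {fset V} :=
  [fset y in iter r (thicken cnbr) [fset x] | (dist x y <= r)%N]%fset.

Lemma in_gball x r y : (y \in gball x r) = (dist x y <= r)%N.
Proof. by rewrite !inE /=; apply: andb_idl; exact: dist_ball. Qed.

(** Apply [transport_escape] to the [k]-step walk restricted to displacements at most [r]: each
    vertex sends at least [c], and what does not land in [S] has escaped. *)
Lemma return_ge S k r (c : R) (x0 : V) :
  (forall x, c <= iter k A (ind R (gball x r)) x) ->
  c * #|` S|%:R - r%:R * (edge_cost x0 * boundary_weight P S) <=
  \sum_(x <- S) iter k A (ind R S) x.
Proof.
move=> hc; pose K x y := iter k A (ind R [fset y]%fset) x * (dist x y <= r)%:R.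
have p0 x y : 0 <= iter k A (ind R [fset y]%fset) x.
  by apply: (iter_ge0 HP) => z; exact: ind_ge0.
have Kle x y : K x y <= iter k A (ind R [fset y]%fset) x.
  by rewrite /K; case: (_ <= _)%N; rewrite ?mulr1// mulr0.
have sumW W x : \sum_(y <- W) iter k A (ind R [fset y]%fset) x = iter k A (ind R W) x.
  rewrite [RHS](iter_kernelE HP _ _ (@supp_ind R V W)).
  by apply: eq_big_seq => y yW; rewrite {3}/ind yW mulr1.
have hK : transport K r.
  split.
  - by move=> f hf x y; rewrite /K iter_ind_aut// dist_aut.
  - by move=> x y; rewrite /K mulr_ge0.
  - by move=> x y; apply: contraNT => /negbTE d; rewrite /K d mulr0.
  - move=> x W; apply: (@le_trans _ _ (iter k A (ind R W) x)).
      by rewrite -sumW; apply: ler_sum => y _; exact: Kle.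
    by apply: (iter_le1 HP) => z; exact: ind_le1.
pose W := (S `|` \bigcup_(x <- S) gball x r)%fset.
rewrite lerBlDr; apply: (@le_trans _ _ (\sum_(x <- S) (iter k A (ind R S) x +
   \sum_(y <- W | y \notin S) K x y))); last first.
  by rewrite big_split lerD2l; exact: transport_escape.
rewrite card_fset_sum1 natr_sum mulr_sumr big_seq [leRHS]big_seq.
apply: ler_sum => x xS; rewrite mulr1; apply: (le_trans (hc x)).
apply: (@le_trans _ _ (\sum_(y <- W) K x y)).
  rewrite -sumW; apply: (@le_trans _ _ (\sum_(y <- gball x r) K x y)).
    rewrite big_seq [leRHS]big_seq; apply: ler_sum => y; rewrite in_gball /K => ->.
    by rewrite mulr1.
  apply: sum_set_le => [y|y yb]; first exact: (transport_ge0 hK).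
  rewrite inE; apply/orP; right.
  by apply/bigfcupP; exists x => //; rewrite xS.
rewrite (bigID (fun y => y \in S))/= lerD2r -sumW big_mkcond.
apply: (@le_trans _ _ (\sum_(y <- S) if y \in S then K x y else 0)).
  apply: sum_le_supp => y; last by move=> /negbTE ->.
  by case: ifP => // _; exact: (transport_ge0 hK).
by apply: ler_sum => y _; case: ifP => _; rewrite ?Kle.
Qed.

End Walk.
End Graphs.

Lemma limn_einf_gt0 (R : realType) (u : (\bar R)^nat) : (0 < limn_einf u)%E ->
  exists (c : R) (n0 : nat), 0 < c /\ forall n, (n0 <= n)%N -> (c%:E <= u n)%E.
Proof.
rewrite limn_einf_lim (cvg_lim _ (@cvg_einfs_sup _ u))//.
move=> /ereal_sup_gt[_ [n0 _ <-] un0].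
have lb n : (n0 <= n)%N -> (einfs u n0 <= u n)%E.
  by move=> n0n; apply: ereal_inf_lbound; exists n.
move: un0 lb; case: (einfs u n0) => [r|_|//].
  by rewrite lte_fin => r0 lb; exists r, n0.
(* For an infinite tail infimum any positive constant works. *)
by move=> lb; exists 1, n0; split=> // n /lb; apply: le_trans; rewrite leey.
Qed.

(** * From diffusivity to the comparison of the profiles *)

Section DiffusiveWalk.
Context (R : realType) (V : choiceType) (e : rel V).
Hypotheses (e_simple : simple_graph e) (e_conn : graph_connected e).
Hypotheses (e_fin : locally_finite e) (e_trans : vertex_transitive e).

Local Notation dist := (graph_dist e).
Local Notation P := (srw_matrix e R).
Local Notation A := (matrix_apply P).

Let HP := srw_kernel e_simple e_fin e_trans R.

Lemma iter_gball_const k r x y :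
  iter k A (ind R (gball e x r)) x = iter k A (ind R (gball e y r)) y.
Proof.
have [f [hf <-]] := e_trans x y; rewrite (iter_aut e_fin e_trans _ _ _ hf).
congr (iter k A _ x); apply/funext => z /=.
by rewrite /ind !in_gball// dist_aut.
Qed.

Section Process.
Local Open Scope classical_set_scope.
Local Open Scope ring_scope.
Context (d : measure_display) (T : measurableType d) (Pr : probability T R).
Context (X : nat -> T -> V).
Hypothesis X_srw : simple_random_walk e Pr X.

(** Given [X 0], this is [markov_bound], and by transitivity the bound does not depend on the
    starting point. Starting points are exhausted by finite balls, and continuity of the measure
    passes to the limit. *)
Lemma Pr_dist_le k r x0 :
  (Pr [set w | (dist (X 0%N w) (X k w) <= r)%N] <=
   (iter k A (ind R (gball e x0 r)) x0)%:E)%E.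
Proof.
set c := iter k A _ x0; set E := [set w | _].
have c0 : 0 <= c by apply: (iter_ge0 HP) => y; exact: ind_ge0.
pose G v := cylinder X 0 (fun=> v) `&` X (0 + k)%N @^-1` [set` gball e v r].
have mG v : measurable (G v).
  apply: measurableI; first exact: (measurable_cylinder X_srw).
  exact: (measurable_seq X_srw).
have cyl0 v : cylinder X 0 (fun=> v) = X 0%N @^-1` [set v].
  apply/seteqP; split=> [w /(_ 0%N)|w h i /=]; first exact.
  by rewrite ltnS leqn0 => /eqP ->.
have EG v : E `&` X 0%N @^-1` [set v] = G v.
  apply/seteqP; split=> w; rewrite /G cyl0 /E /= add0n in_gball//.
    by move=> [h <-].
  by move=> [<-].
have mX n (s : {fset V}) : measurable (X n @^-1` [set` s]) by exact: (measurable_seq X_srw).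
have cover : \bigcup_m (X 0%N @^-1` [set` gball e x0 m]) = setT.
  apply/seteqP; split=> // w _; exists (dist x0 (X 0%N w)) => //=.
  by rewrite in_gball.
have mE : measurable E.
  rewrite (_ : E = \bigcup_m \big[setU/set0]_(v <- gball e x0 m) G v).
    by apply: bigcupT_measurable => m; exact: bigsetU_measurable.
  apply/seteqP; split=> w.
    move=> Ew; exists (dist x0 (X 0%N w)) => //.
    rewrite -bigcup_seq; exists (X 0%N w); first by rewrite /= in_gball.
    by rewrite -EG.
  by move=> [m _]; rewrite -bigcup_seq => -[v _]; rewrite -EG => -[].
pose F m := E `&` X 0%N @^-1` [set` gball e x0 m].
have mF m : measurable (F m) by exact: measurableI.
have EF : E = \bigcup_m F m by rewrite -setI_bigcupr cover setIT.
have F_le m : (Pr (F m) <= c%:E)%E.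
  rewrite /F (Pr_seq X_srw _ mE) ?fset_uniq//.
  apply: (@le_trans _ _ (\sum_(v <- gball e x0 m)
      Pr (setT `&` X 0%N @^-1` [set v]) * c%:E)%E).
    apply: lee_sum => v _; rewrite EG /c (iter_gball_const k r x0 v) setTI -cyl0.
    exact: (markov_bound HP X_srw k 0 (fun=> v)).
  rewrite -ge0_sume_distrl; last by move=> v _; exact: measure_ge0.
  rewrite -(Pr_seq X_srw _ measurableT) ?fset_uniq//.
  rewrite -[leRHS]mul1e lee_wpmul2r ?lee_fin//.
  by rewrite setTI; exact: probability_le1 (mX _ _).
have mono : {homo F : n m / (n <= m)%N >-> (n <= m)%O}.
  move=> n m nm; apply/subsetPset => w [Ew wn]; split=> //; move: wn.
  by rewrite /= !in_gball// => /leq_trans; apply.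
have cvF := nondecreasing_cvg_mu (mu := Pr) mF (bigcupT_measurable _ mF) mono.
rewrite EF -(cvg_lim _ cvF)//; apply: lime_le; first by apply/cvg_ex; exists (Pr (\bigcup_m F m)).
by apply: nearW => m; exact: F_le.
Qed.

Lemma diffusive_return : diffusive e Pr X ->
  exists (c C : R) (n0 : nat), [/\ 0 < c, 0 < C & forall n, (n0 <= n)%N ->
    exists r : nat, r%:R <= C * Num.sqrt n%:R /\
      forall x, c <= iter n A (ind R (gball e x r)) x].
Proof.
move=> [C /limn_einf_gt0[c [n0 [c0 h]]]]; exists c, (`|C| + 1), n0.
split=> //.
(* A negative radius would make the event empty, against its positive probability. *)
move=> n /h hn; have [C0|C0] := leP 0 (C * Num.sqrt n%:R); last first.
  exfalso; move: hn; rewrite (_ : [set w | _] = set0).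
    by rewrite measure0 lee_fin leNgt c0.
  apply/seteqP; split=> // w /=; apply/negP; rewrite -ltNge.
  exact: lt_le_trans C0 _.
(* Rounding the radius down keeps the event, since distances are integers. *)
exists (Num.trunc (C * Num.sqrt n%:R)); split.
  apply: (@le_trans _ _ (C * Num.sqrt n%:R)); first by rewrite truncn_le.
  by rewrite ler_wpM2r ?sqrtr_ge0// (le_trans (ler_norm C))// lerDl.
move=> x; rewrite -lee_fin; apply: le_trans (Pr_dist_le n _ x).
apply: (le_trans hn); rewrite le_eqVlt; apply/orP; left; apply/eqP.
by congr (Pr _); apply/seteqP; split=> w /=; rewrite truncn_ge_nat.
Qed.

End Process.

Local Notation bw := (boundary_weight P).
Local Notation Lam := (spectral_profile P).

(* Since [sqrt (2 m)] is small compared to [|S| / bw S], the walk started in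
   [S] has not yet noticed the boundary at time [2 m]. *)
Lemma spectral_profile_diffusive_scale (c C : R) (n0 m : nat) (S : {fset V})
    (x0 : V) (n : R) :
  (forall eps : R, 0 < eps ->
    exists2 S : {fset V}, S != fset0 & bw S <= eps * #|` S|%:R) ->
  0 < c -> 0 < C ->
  (forall n, (n0 <= n)%N -> exists r : nat, r%:R <= C * Num.sqrt n%:R /\
      forall x, c <= iter n A (ind R (gball e x r)) x) ->
  S != fset0 -> (0 < m)%N -> (n0 <= m)%N ->
  8 * (C * edge_cost e R x0) ^+ 2 * m%:R * bw S ^+ 2 <= (c * #|` S|%:R) ^+ 2 ->
  32 / c * #|` S|%:R <= n ->
  Lam n <= 8 / (c * m%:R).
Proof.
move=> folner c0 C0 hret S0 m0 n0m hm hn.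
have D0 := edge_cost_gt0 e R x0; set D := edge_cost e R x0 in hm D0.
have b0 := boundary_weight_ge0 HP S; set b := bw S in hm b0.
set s : R := #|` S|%:R in hm hn.
have s0 : 0 <= s by rewrite ler0n.
(* The squared norm of [P^m 1_S] is the return mass at time [2 m]. *)
have [r [hr hc]] := hret (m + m)%N (leq_trans n0m (leq_addr _ _)).
(* At most half of the mass [c * s] escapes, so [c / 2] replaces [c] below; squaring removes the
   square root. *)
have cs : r%:R * (D * b) <= c / 2 * s.
  rewrite -(@ler_pXn2r _ 2)// ?nnegrE; last 2 first.
  - by rewrite mulr_ge0// mulr_ge0// ltW.
  - by rewrite mulr_ge0// divr_ge0// ltW.
  have r2 : r%:R ^+ 2 <= C ^+ 2 * (m%:R + m%:R).
    have -> : C ^+ 2 * (m%:R + m%:R) = (C * Num.sqrt (m + m)%:R) ^+ 2 :> R.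
      by rewrite exprMn sqr_sqrtr// natrD.
    by rewrite lerXn2r// nnegrE// mulr_ge0 ?sqrtr_ge0// ltW.
  rewrite exprMn; apply: (@le_trans _ _ (C ^+ 2 * (m%:R + m%:R) * (D * b) ^+ 2)).
    by rewrite ler_wpM2r// sqr_ge0.
  have -> : C ^+ 2 * (m%:R + m%:R) * (D * b) ^+ 2 =
    (8 * (C * D) ^+ 2 * m%:R * b ^+ 2) / 4 by field.
  have -> : (c / 2 * s) ^+ 2 = (c * s) ^+ 2 / 4 by field.
  by rewrite ler_pM2r.
have := return_ge e_simple e_conn e_fin e_trans folner S x0 hc.
rewrite -/D -/b -/s => ret.
have -> : 8 / (c * m%:R) = 4 / (c / 2 * m%:R).
  by field; rewrite gt_eqF ?ltr0n// gt_eqF.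
apply: (spectral_profile_smoothing HP S0 m0); first by rewrite divr_gt0.
  rewrite (iter_adjoint HP _ _ (@supp_ind R V S)) -iterD.
  rewrite (l2_innerEl _ (@supp_ind R V S)) -/s.
  rewrite (eq_big_seq (fun x => iter (m + m) A (ind R S) x)).
    by apply: le_trans ret; lra.
  by move=> x xS; rewrite {1}/ind xS mul1r.
apply: le_trans hn; rewrite -/s le_eqVlt; apply/orP; left; apply/eqP.
by field; rewrite gt_eqF.
Qed.

(** If boundary ratios are bounded below, [Lam n <= 1] suffices; otherwise take [m] of the order of
    the inverse square of the boundary ratio. The inequality is multiplied out to allow
    [bw S = 0]. *)
Lemma spectral_profile_le_boundary (c C : R) (n0 : nat) (x0 : V) :
  0 < c -> 0 < C ->
  (forall n, (n0 <= n)%N -> exists r : nat, r%:R <= C * Num.sqrt n%:R /\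
      forall x, c <= iter n A (ind R (gball e x r)) x) ->
  exists K L : R, [/\ 1 <= K, 0 < L & forall (S : {fset V}) (n : R),
    S != fset0 -> K * #|` S|%:R <= n ->
    Lam n * #|` S|%:R ^+ 2 <= L * bw S ^+ 2].
Proof.
move=> c0 C0 hret.
have card1 (K : R) (S : {fset V}) n : 1 <= K -> S != fset0 ->
    K * #|` S|%:R <= n -> 1 <= n.
  move=> K1 S0; apply: le_trans; apply: mulr_ege1 => //.
  by rewrite ler1n cardfs_gt0.
have [folner|] := pselect (forall eps : R, 0 < eps ->
    exists2 S : {fset V}, S != fset0 & bw S <= eps * #|` S|%:R); last first.
  move=> /existsNP[eps /not_implyP[eps0 nf]].
  exists 1, (eps ^- 2); split=> //; first by rewrite invr_gt0 exprn_gt0.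
  move=> S n S0 hn; have n1 := card1 _ _ _ (lexx 1) S0 hn.
  have L1 := spectral_profile_le1 HP x0 n1.
  have bS : eps * #|` S|%:R <= bw S.
    by rewrite leNgt; apply/negP => /ltW bS; apply: nf; exists S.
  apply: (@le_trans _ _ (#|` S|%:R ^+ 2)).
    by rewrite -[leRHS]mul1r ler_wpM2r// sqr_ge0.
  rewrite mulrC ler_pdivlMr ?exprn_gt0// mulrC -exprMn.
  by rewrite lerXn2r// nnegrE ?mulr_ge0 ?(ltW eps0)// (boundary_weight_ge0 HP).
(* Turns the condition on the scale into [m%:R * bw S ^+ 2 <= delta * s ^+ 2], with [s] the size of
   [S]. *)
pose delta := c ^+ 2 / (8 * (C * edge_cost e R x0) ^+ 2).
have D0 := edge_cost_gt0 e R x0.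
have delta0 : 0 < delta.
  by rewrite divr_gt0 ?exprn_gt0// mulr_gt0// exprn_gt0// mulr_gt0.
pose n1 : R := n0.+1%:R.
have n10 : 0 < n1 by rewrite ltr0n.
(* The [+ 1] ensures [1 <= n]. The first summand of [L] serves sets of large boundary ratio, where
   [Lam n <= 1] suffices, the second all others. *)
exists (32 / c + 1), (2 * n1 / delta + 16 / (c * delta)); split.
- by rewrite lerDr divr_ge0// ltW.
- by rewrite addr_gt0// divr_gt0// mulr_gt0.
move=> S n S0 hn.
have K1 : 1 <= 32 / c + 1 by rewrite lerDr divr_ge0// ltW.
have n_ge1 := card1 _ _ _ K1 S0 hn.
have L1 := spectral_profile_le1 HP x0 n_ge1.
have b0 := boundary_weight_ge0 HP S.
have s0 : (0 : R) < #|` S|%:R by rewrite ltr0n cardfs_gt0.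
have hn' : 32 / c * #|` S|%:R <= n.
  by apply: le_trans hn; rewrite ler_wpM2r ?(ltW s0)// lerDl.
have scale m : (n0 < m)%N -> m%:R * bw S ^+ 2 <= delta * #|` S|%:R ^+ 2 ->
    Lam n <= 8 / (c * m%:R).
  move=> n0m hm.
  apply: (spectral_profile_diffusive_scale (x0 := x0) folner c0 C0 hret S0 _ (ltnW n0m)) => //.
    exact: leq_ltn_trans n0m.
  have -> : (c * #|` S|%:R) ^+ 2 =
      8 * (C * edge_cost e R x0) ^+ 2 * (delta * #|` S|%:R ^+ 2).
    by rewrite /delta; field; rewrite !gt_eqF.
  by rewrite -mulrA ler_wpM2l// mulr_ge0// sqr_ge0.
move: (bw S) (#|` S|%:R) b0 s0 scale => b s b0 s0 scale {hn hn'}; clearbody delta.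
have s2 : 0 < s ^+ 2 by rewrite exprn_gt0.
have t1 : 0 <= 2 * n1 / delta * b ^+ 2.
  apply: mulr_ge0 (sqr_ge0 _). by rewrite divr_ge0 ?mulr_ge0 ?(ltW n10) ?(ltW delta0).
have t2 : 0 <= 16 / (c * delta) * b ^+ 2.
  by apply: mulr_ge0 (sqr_ge0 _); rewrite divr_ge0 ?mulr_ge0 ?(ltW c0) ?(ltW delta0).
rewrite mulrDl.
have [big|small] := leP (delta * s ^+ 2) (2 * n1 * b ^+ 2).
  apply: (@le_trans _ _ (2 * n1 / delta * b ^+ 2)); last by rewrite lerDl.
  apply: (@le_trans _ _ (s ^+ 2)); first by rewrite -[leRHS]mul1r ler_wpM2r// ltW.
  by rewrite mulrAC ler_pdivlMr// mulrC.
have [Lneg|Lpos] := leP (Lam n) 0.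
  by apply: (@le_trans _ _ 0); [rewrite mulr_le0_ge0// ltW | rewrite addr_ge0].
have [b_eq0|b_neq0] := eqVneq b 0.
  (* With zero boundary, as for all of a finite graph, every [m > n0] is admissible; a large one
     contradicts [0 < Lam n]. *)
  exfalso; pose m := maxn n0.+1 (Num.trunc (8 / (c * Lam n))).+1.
  have m_gt : 8 / (c * Lam n) < m%:R.
    apply: (lt_le_trans (truncnS_gt _)); rewrite ler_nat; exact: leq_maxr.
  have m0 : (0 : R) < m%:R by rewrite ltr0n leq_max.
  have : Lam n <= 8 / (c * m%:R).
    apply: scale; first exact: leq_maxl.
    by rewrite b_eq0 expr0n/= mulr0 mulr_ge0// ltW.
  rewrite leNgt => /negP; apply.
  rewrite ltr_pdivrMr ?mulr_gt0//; move: m_gt.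
  rewrite ltr_pdivrMr ?mulr_gt0// => /lt_le_trans; apply.
  by rewrite le_eqVlt; apply/orP; left; apply/eqP; ring.
have b_gt0 : 0 < b by rewrite lt_neqAle eq_sym b_neq0.
have b2 : 0 < b ^+ 2 by rewrite exprn_gt0.
(* The largest real scale allowed; as [q > 2 * n1 >= 2], its integer part exceeds [n0] and is at
   least [q / 2]. *)
pose q := delta * s ^+ 2 / b ^+ 2.
have q0 : 0 < q by rewrite divr_gt0// mulr_gt0.
have qn : 2 * n1 < q by rewrite ltr_pdivlMr.
pose m := Num.trunc q.
have /andP[mq qm] := truncn_itv (ltW q0); rewrite -/m in mq qm.
have n1_ge1 : 1 <= n1 by rewrite ler1n.
have mS : m.+1%:R = m%:R + 1 :> R by rewrite -addn1 natrD.
rewrite mS in qm.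
have hm : (n0 < m)%N.
  rewrite -(ltr_nat R); have : n1 = n0%:R + 1 by rewrite /n1 -addn1 natrD.
  lra.
have m_ge : q / 2 <= m%:R by lra.
have m0 : (0 : R) < m%:R by rewrite ltr0n (leq_ltn_trans _ hm).
have {}scale : Lam n <= 8 / (c * m%:R).
  by apply: scale => //; rewrite -ler_pdivlMr.
apply: (@le_trans _ _ (16 / (c * delta) * b ^+ 2)); last by rewrite lerDr.
have -> : 16 / (c * delta) * b ^+ 2 = 16 / (c * q) * s ^+ 2.
  by rewrite /q; field; rewrite !gt_eqF.
rewrite ler_wpM2r ?(ltW s2)//; apply: (le_trans scale).
have cm0 : 0 < c * m%:R by rewrite mulr_gt0.
have cq0 : 0 < c * q by rewrite mulr_gt0.
rewrite ler_pdivrMr// mulrAC ler_pdivlMr//.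
have : c * q <= c * (2 * m%:R) by rewrite ler_pM2l//; lra.
lra.
Qed.

End DiffusiveWalk.

Theorem corollary1p4 (R : realType) (V : choiceType) (e : rel V)
    (d : measure_display) (T : measurableType d) (Pr : probability T R)
    (X : nat -> T -> V) :
  simple_graph e ->
  graph_connected e ->
  locally_finite e ->
  vertex_transitive e ->
  simple_random_walk e Pr X ->
  diffusive e Pr X ->
  asymp_equiv (spectral_profile (srw_matrix e R))
    (fun x => isoperimetric_profile (srw_matrix e R) x ^+ 2).
Proof.
move=> e_simple e_conn e_fin e_trans X_srw X_diff.
have HP := srw_kernel e_simple e_fin e_trans R.
(* The sample space has mass 1, hence a point, and [X 0] maps it to a vertex. *)
have [x0] : inhabited V.
  apply: contrapT => noV.
  have T0 : ([set: T] = set0)%classic.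
    by apply/seteqP; split=> // w _; apply: noV; exists; exact: X 0%N w.
  have := probability_setT Pr; rewrite T0 measure0 => /eqP.
  by rewrite eq_sym onee_eq0.
have [c [C [n0 [c0 C0 hret]]]] :=
  diffusive_return e_simple e_conn e_fin e_trans X_srw X_diff.
have [K [L [K1 L0 main]]] :=
  spectral_profile_le_boundary e_simple e_conn e_fin e_trans x0 c0 C0 hret.
(* [K] allows for the growth of supports under smoothing, 8 is Cheeger's constant, and from the
   threshold 1 on the profiles are infima of nonempty families. *)
exists L^-1, K, 8, 1, 1; split.
  by split=> //; [rewrite invr_gt0 | exact: lt_le_trans K1].
move=> x x1; apply/andP; split; last first.
  by rewrite mul1r; exact: (profile_cheeger HP x0).
set Lam := spectral_profile _ _.
have Lam0 : 0 <= L^-1 * Lam.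
  rewrite mulr_ge0 ?invr_ge0 ?(ltW L0)//.
  apply: (le_spectral_profile x0); first exact: mulr_ege1.
  by move=> S f _ _ h; rewrite mul0r (dirichlet_ge0 HP h).
(* Square roots turn the claim into a lower bound on an infimum, checked set by set. *)
rewrite -[leLHS]sqr_sqrtr// lerXn2r ?nnegrE ?sqrtr_ge0//.
  exact: (isoperimetric_profile_ge0 HP x0).
apply: (le_isoperimetric_profile x0) => // S S0 Sx.
have s0 : (0 : R) < #|` S|%:R by rewrite ltr0n cardfs_gt0.
rewrite ler_pdivlMr// -(@ler_pXn2r _ 2)// ?nnegrE; last 2 first.
- by rewrite mulr_ge0 ?sqrtr_ge0.
- exact: (boundary_weight_ge0 HP).
rewrite exprMn sqr_sqrtr// -mulrA mulrC ler_pdivrMr// [leRHS]mulrC.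
by apply: main => //; rewrite ler_wpM2l// (le_trans _ K1).
Qed.
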